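(* Let $n\ge 2$, let $\Omega\subset\mathbb{R}^n$ be a domain with $C^2$ boundary $\partial\Omega$, let $\delta(\mathbf{x})=\operatorname{dist}(\mathbf{x},\mathbb{R}^n\setminus\Omega)$, and let $\mathcal{R}(\Omega)$ be the ridge of $\Omega$, assumed closed relative to $\Omega$. For $\mathbf{x}\in\Omega\setminus\mathcal{R}(\Omega)$ put $$\tilde\kappa(\mathbf{x})=\sum_{i=1}^{n-1}\frac{\kappa_i}{1+\delta(\mathbf{x})\kappa_i},$$ where $\kappa_1,\dots,\kappa_{n-1}$ are the principal curvatures of $\partial\Omega$ at the near point $N(\mathbf{x})$ of $\mathbf{x}$. Then for every $p\in(1,\infty)$ and every $f\in C_0^\infty(\Omega\setminus\mathcal{R}(\Omega))$, $$\int_\Omega |\nabla\delta\cdot\nabla f|^p\,d\mathbf{x}\ \ge\ \left(\frac{p-1}{p}\right)^p\int_\Omega\left\{1-\frac{p\,\delta\,\tilde\kappa}{p-1}\right\}\frac{|f|^p}{\delta^p}\,d\mathbf{x}.$$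
   Context: A domain is an open connected set. $\partial\Omega\in C^2$ means that locally, after a rotation of coordinates, $\partial\Omega$ is the graph of a $C^2$ function of $n-1$ variables. For $\mathbf{x}\in\Omega$ let $N(\mathbf{x})=\{\mathbf{y}\in\partial\Omega: |\mathbf{y}-\mathbf{x}|=\delta(\mathbf{x})\}$ be the set of near points of $\mathbf{x}$; when $N(\mathbf{x})=\{\mathbf{y}\}$ one writes $N(\mathbf{x})=\mathbf{y}$. The skeleton is $\mathcal{S}(\Omega)=\{\mathbf{x}\in\Omega: \operatorname{card}N(\mathbf{x})>1\}$. For $\mathbf{x}\in\Omega$ and $\mathbf{y}\in N(\mathbf{x})$ put $\lambda=\sup\{t\in(0,\infty): \mathbf{y}\in N(\mathbf{y}+t[\mathbf{x}-\mathbf{y}])\}$; when $\lambda<\infty$, $\mathbf{y}+\lambda[\mathbf{x}-\mathbf{y}]$ is the ridge point of $\mathbf{x}$, and the ridge $\mathcal{R}(\Omega)$ is the set of all ridge points. One has $\mathcal{S}(\Omega)\subseteq\mathcal{R}(\Omega)\subseteq\overline{\mathcal{S}(\Omega)}$, so each $\mathbf{x}\in\Omega\setminus\mathcal{R}(\Omega)$ has a unique near point. Standing assumption: $\mathcal{R}(\Omega)$ is closed relative to $\Omega$. Sign convention for principal curvatures: if $\mathbf{n}$ is the unit normal to $\partial\Omega$ pointing into $\Omega$ and $\mathbf{v}_i$ are orthonormal principal directions, then $\kappa_i$ is defined by $\partial_{\mathbf{v}_i}\mathbf{n}=\kappa_i\mathbf{v}_i$. (Thus the $\kappa_i$ are non-positive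 when $\Omega$ is convex, e.g. $-1/R$ for a ball of radius $R$.) *)

(* Defs.v *)
From HB Require Import structures.
From mathcomp Require Import all_boot all_order all_algebra.
From mathcomp Require Import all_classical all_reals all_analysis.

Set Implicit Arguments.
Unset Strict Implicit.
Unset Printing Implicit Defensive.
Import Order.TTheory GRing.Theory Num.Theory.
Import numFieldNormedType.Exports.
Local Open Scope classical_set_scope.
Local Open Scope ring_scope.

(* R^n is 'rV[R]_n, with the sigma-algebra generated by the coordinates.
   Lebesgue measure on it is obtained by iterating the product with the
   one-dimensional Lebesgue measure (see [lebesgue_rV_box]). *)

Section measurable_rV.
Variables (R : realType) (n : nat).

Definition rV_coord (i : 'I_n) (x : 'rV[R]_n) : measurableTypeR R := x ord0 i.

HB.instance Definition _ := @isMeasurable.Build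
  default_measure_display 'rV[R]_n
  (g_sigma_preimage rV_coord)
  (@sigma_algebra0 _ _ _)
  (@sigma_algebraC _ _)
  (@sigma_algebra_bigcup _ _ _).

Lemma measurable_rV_coord (i : 'I_n) : measurable_fun setT (rV_coord i).
Proof.
move=> _ Y mY; rewrite setTI; apply: sub_sigma_algebra => /=.
rewrite -bigcup_seq/=; exists i => /=; first by rewrite mem_index_enum.
by exists Y => //; rewrite setTI.
Qed.

Lemma measurable_fun_rV d (T : measurableType d) (f : T -> 'rV[R]_n) :
  (forall i, measurable_fun setT (rV_coord i \o f)) -> measurable_fun setT f.
Proof.
move=> mf _ A mA; rewrite setTI.
have : preimage_set_system setT f (g_sigma_preimage rV_coord) (f @^-1` A).
  by exists A => //; rewrite setTI.
rewrite -g_sigma_preimage_comp; move: (f @^-1` A).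
apply: smallest_sub; first exact: sigma_algebra_measurable.
rewrite -bigcup_seq => B [i _] [C mC <-].
exact: mf.
Qed.

End measurable_rV.

Section lebesgue_step.
Variables (R : realType) (n : nat).

Definition rV_cons (p : measurableTypeR R * 'rV[R]_n) : 'rV[R]_n.+1 :=
  row_mx (const_mx p.1 : 'rV[R]_1) p.2.

Definition rV_uncons (x : 'rV[R]_n.+1) : measurableTypeR R * 'rV[R]_n :=
  (rV_coord ord0 x, \row_i x ord0 (lift ord0 i)).

Lemma rV_cons0 p : rV_coord ord0 (rV_cons p) = p.1.
Proof.
rewrite /rV_coord /rV_cons mxE; case: splitP => j; last by [].
by rewrite mxE.
Qed.

Lemma rV_consS p i : rV_coord (lift ord0 i) (rV_cons p) = p.2 ord0 i.
Proof.
rewrite /rV_coord /rV_cons mxE; case: splitP => j.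
  by rewrite ord1.
by move=> /= /eqP; rewrite /bump add1n eqSS => /eqP/val_inj ->.
Qed.

Lemma rV_consK : cancel rV_cons rV_uncons.
Proof.
move=> p; rewrite /rV_uncons rV_cons0 [RHS]surjective_pairing; congr pair.
by apply/rowP => i; rewrite mxE -rV_consS.
Qed.

Lemma measurable_rV_cons : measurable_fun setT rV_cons.
Proof.
apply: measurable_fun_rV => i; case: (unliftP ord0 i) => [j|] ->.
  rewrite (_ : _ \o _ = rV_coord j \o snd); last first.
    by apply/funext => p /=; rewrite rV_consS.
  by apply: measurableT_comp => //; exact: measurable_rV_coord.
rewrite (_ : _ \o _ = fst)//.
by apply/funext => p /=; rewrite rV_cons0.
Qed.

Lemma measurable_rV_uncons : measurable_fun setT rV_uncons.
Proof.
apply/measurable_fun_pairP; split; first exact: measurable_rV_coord.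
apply: measurable_fun_rV => i.
rewrite (_ : _ \o _ = rV_coord (lift ord0 i)); first exact: measurable_rV_coord.
by apply/funext => x /=; rewrite /rV_coord mxE.
Qed.

Variable mu : {sigma_finite_measure set 'rV[R]_n -> \bar R}.

Definition lebesgue_step : set 'rV[R]_n.+1 -> \bar R :=
  pushforward (lebesgue_measure \x mu)%E rV_cons.

Let prod : {measure set (measurableTypeR R * 'rV[R]_n)%type -> \bar R} :=
  (lebesgue_measure \x mu)%E.

Let prod_sigma_finite : sigma_finite setT prod.
Proof.
have /sigma_finiteP[F [TF ndF Foo]] := sigma_finiteT (@lebesgue_measure R).
have /sigma_finiteP[G [TG ndG Goo]] := sigma_finiteT mu.
exists (fun k => F k `*` G k).
  rewrite -setXTT TF TG; apply/seteqP; split => -[x y]; last first.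
    by move=> [k _ [/= ? ?]]; split; exists k.
  move=> [/= [k _ Fx] [l _ Gy]]; exists (maxn k l) => //; split => /=.
    by move: x Fx; exact/subsetPset/ndF/leq_maxl.
  by move: y Gy; exact/subsetPset/ndG/leq_maxr.
move=> k; have [? ?] := Foo k; have [? ?] := Goo k.
split; first exact: measurableX.
by rewrite /prod /= product_measure1E// lte_mul_pinfty// ge0_fin_numE.
Qed.

Let measurable_preimage_cons A :
  measurable A -> measurable (rV_cons @^-1` A).
Proof.
by move=> mA; rewrite -[X in measurable X]setTI; exact: measurable_rV_cons.
Qed.

Let lebesgue_step0 : lebesgue_step set0 = 0%E.
Proof. by rewrite /lebesgue_step /pushforward preimage_set0 measure0. Qed.

Let lebesgue_step_ge0 A : (0 <= lebesgue_step A)%E.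
Proof. exact: (measure_ge0 prod). Qed.

Let lebesgue_step_sigma_additive : semi_sigma_additive lebesgue_step.
Proof.
move=> F mF tF mUF; rewrite /lebesgue_step /pushforward preimage_bigcup.
apply: (@measure_semi_sigma_additive _ _ _ prod).
- by move=> i; exact: measurable_preimage_cons.
- apply/trivIsetP => i j _ _ ij; rewrite -preimage_setI.
  by move/trivIsetP : tF => /(_ _ _ _ _ ij) ->//; rewrite preimage_set0.
- by rewrite -preimage_bigcup; exact: measurable_preimage_cons.
Qed.

HB.instance Definition _ := isMeasure.Build _ _ _ lebesgue_step
  lebesgue_step0 lebesgue_step_ge0 lebesgue_step_sigma_additive.

Let lebesgue_step_sigma_finite : sigma_finite setT lebesgue_step.
Proof.
have [G TG Goo] := prod_sigma_finite.
exists (fun k => rV_uncons @^-1` G k).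
  by rewrite -preimage_bigcup -TG.
move=> k; have [mG Gk] := Goo k; split.
  by rewrite -[X in measurable X]setTI; exact: measurable_rV_uncons.
rewrite /lebesgue_step /pushforward -comp_preimage.
by rewrite (_ : _ \o _ = id)//; apply/funext; exact: rV_consK.
Qed.

HB.instance Definition _ := Measure_isSigmaFinite.Build _ _ _ lebesgue_step
  lebesgue_step_sigma_finite.

End lebesgue_step.

Fixpoint lebesgue_rV (R : realType) (n : nat) :
    {sigma_finite_measure set 'rV[R]_n -> \bar R} :=
  match n with
  | 0 => \d_(0 : 'rV[R]_0)
  | m.+1 => lebesgue_step (lebesgue_rV R m)
  end.

Lemma lebesgue_rV_box (R : realType) (n : nat) (a b : 'I_n -> R) :
  (forall i, a i <= b i) ->
  lebesgue_rV R n [set x | forall i, a i <= x ord0 i <= b i] =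
  (\prod_i (b i - a i))%:E.
Proof.
elim: n a b => [a b _|n IH a b ab].
  rewrite big_ord0 /= diracE mem_set//.
  by case.
rewrite /= /lebesgue_step /pushforward.
rewrite (_ : _ @^-1` _ = `[a ord0, b ord0]%classic `*`
  [set x : 'rV[R]_n | forall i, a (lift ord0 i) <= x ord0 i <= b (lift ord0 i)]);
  last first.
  apply/seteqP; split => [[t x] /= h|[t x] /= [h0 h] i].
    split=> [|i]; first by have := h ord0; rewrite -/(rV_coord _ _) rV_cons0 in_itv.
    by have := h (lift ord0 i); rewrite -/(rV_coord _ _) rV_consS.
  rewrite -/(rV_coord _ _); case: (unliftP ord0 i) => [j|] ->.
    by rewrite rV_consS; exact: h.
  by rewrite rV_cons0; move: h0; rewrite in_itv.
rewrite product_measure1E//; last first.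
  rewrite (_ : mkset _ = \bigcap_(i in [set: 'I_n])
     (@rV_coord R n i @^-1` `[a (lift ord0 i), b (lift ord0 i)]%classic)).
    apply: fin_bigcap_measurable => // i _.
    by rewrite -[X in measurable X]setTI; apply: measurable_rV_coord.
  apply/seteqP; split => x /= h i; first by move=> _; rewrite /= in_itv; exact: h.
  by have := h i I; rewrite /= in_itv.
rewrite IH// big_ord_recl EFinM; congr (_ * _)%E.
rewrite [LHS](_ : _ = lebesgue_measure `[a ord0, b ord0]%classic)//.
rewrite lebesgue_measure_itv /= lte_fin.
have := ab ord0; rewrite le_eqVlt => /predU1P[->|->//].
by rewrite ltxx subrr.
Qed.

Section euclidean.
Variables (R : realType) (n : nat).
Implicit Types (u v x y : 'rV[R]_n) (S U : set 'rV[R]_n) (f : 'rV[R]_n -> R).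

Definition dotp u v : R := \sum_i u ord0 i * v ord0 i.

(* The library norm `|x| on 'rV[R]_n is the sup norm; it is used below only
   through the topology it induces. *)
Definition enorm u : R := Num.sqrt (dotp u u).

Definition grad f x : 'rV[R]_n := \row_i 'D_(delta_mx ord0 i) f x.

(* f is of class C^k on the open set U: its partial derivatives of order at
   most k exist and are continuous at every point of U. *)
Fixpoint Ck_on U (k : nat) f : Prop :=
  (forall x, U x -> {for x, continuous f}) /\
  match k with
  | 0 => True
  | j.+1 => forall i : 'I_n,
      (forall x, U x -> derivable f x (delta_mx ord0 i)) /\
      Ck_on U j ('D_(delta_mx ord0 i) f)
  end.

Definition fsupport f : set 'rV[R]_n := closure [set x | f x != 0].

(* C_0^oo(U), its elements being extended by 0 to R^n. *)
Definition test_function U f : Prop :=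
  [/\ forall k, Ck_on setT k f, compact (fsupport f) & fsupport f `<=` U].

Definition boundary S : set 'rV[R]_n := closure S `\` S°.

(* Velocities at y of curves lying on S. *)
Definition curve_on S y v (g : R -> 'rV[R]_n) : Prop :=
  [/\ g 0 = y, \forall t \near (0 : R), S (g t) & is_derive (0 : R) 1 g v].

Definition tangent S y v : Prop := exists g, curve_on S y v g.

(* w is the derivative at y, in the direction v, of a map nu which only
   matters on S; meaningful when v is tangent to S at y. *)
Definition derive_along S (nu : 'rV[R]_n -> 'rV[R]_n) y v w : Prop :=
  forall g, curve_on S y v g -> is_derive (0 : R) 1 (nu \o g) w.

End euclidean.

Section domain.
Variables (R : realType) (n : nat) (Omega : set 'rV[R]_n).
Implicit Types (x y z : 'rV[R]_n).

(* Near each of its points and in suitably rotated coordinates z *m Q, the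
   boundary is the graph of a C^2 function phi defined on an open set V; the
   coordinate number j is the dependent one, and col' j drops it. *)
Definition C2_boundary : Prop :=
  forall y, boundary Omega y ->
  exists (Q : 'M[R]_n) (j : 'I_n) (U : set 'rV[R]_n)
         (V : set 'rV[R]_n.-1) (phi : 'rV[R]_n.-1 -> R),
    [/\ Q *m Q^T = 1%:M /\ \det Q = 1,
        open_nbhs y U,
        open V,
        Ck_on V 2 phi
      & forall z, U z ->
          (boundary Omega z <->
           V (col' j (z *m Q)) /\ (z *m Q) ord0 j = phi (col' j (z *m Q)))].

Definition delta x : R := inf [set enorm (z - x) | z in ~` Omega].

Definition near_points x : set 'rV[R]_n :=
  [set y | boundary Omega y /\ enorm (y - x) = delta x].

(* For z outside Omega, delta z = 0 and z is not a point of N (z) other than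
   itself, so that allowing y + t (x - y) to leave Omega adds no value of t. *)
Definition ridge_times x y : set R :=
  [set t | 0 < t /\ near_points (y + t *: (x - y)) y].

(* has_ubound says that the supremum lambda is finite; ridge_times x y
   contains 1. *)
Definition ridge : set 'rV[R]_n :=
  [set z | exists x y, [/\ Omega x, near_points x y,
     has_ubound (ridge_times x y) &
     z = y + sup (ridge_times x y) *: (x - y)]].

(* nu restricted to the boundary is the unit normal pointing into Omega. *)
Definition inner_unit_normal (nu : 'rV[R]_n -> 'rV[R]_n) : Prop :=
  forall y, boundary Omega y ->
    [/\ enorm (nu y) = 1,
        forall v, tangent (boundary Omega) y v -> dotp (nu y) v = 0
      & \forall t \near (0 : R)^'+,
          Omega (y + t *: nu y) /\ ~ Omega (y - t *: nu y)].

(* The curvatures listed with multiplicity, with the sign convention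
   d nu (v_i) = kappa_i v_i for the inner normal nu. *)
Definition principal_curvatures y (kappa : 'I_n.-1 -> R) : Prop :=
  exists (nu : 'rV[R]_n -> 'rV[R]_n) (v : 'I_n.-1 -> 'rV[R]_n),
    [/\ inner_unit_normal nu,
        forall i j, dotp (v i) (v j) = (i == j)%:R
      & forall i, tangent (boundary Omega) y (v i) /\
          derive_along (boundary Omega) nu y (v i) (kappa i *: v i)].

Definition kappa_tilde (kappa : 'I_n.-1 -> R) x : R :=
  \sum_i kappa i / (1 + delta x * kappa i).

End domain.

(* Main.v *)
(* Off the ridge every x has a unique near point N x, and [near_point_ball] at a point
   slightly beyond x shows that N is Lipschitz there. In a C^2 chart of the boundary,
   with normal exponential map P, the chart coordinates U x of (N x, x) are Lipschitz
   and satisfy P (U x) = x, which makes the differential of P invertible; hence N is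
   differentiable. Differentiating x - N x = delta x * nu (N x) along lines shows that
   the differential of N has the eigenvalues 1 / (1 + delta kappa_i) on the principal
   directions and 0 on the normal, so x - N x has divergence 1 + delta kappa_tilde.
   The compactly supported field V = |f/delta|^p (x - N x) is Lipschitz and everywhere
   differentiable, so its divergence has integral 0; the inequality is then the
   integral of the tangent line inequality of |t|^p between (p-1)/p * f/delta and
   grad delta . grad f. *)
From HB Require Import structures.
Require Import Defs.
From mathcomp Require Import all_boot all_order all_algebra.
From mathcomp Require Import all_classical all_reals all_analysis.
From mathcomp Require Import measurable_realfun ring lra.

Import Order.TTheory GRing.Theory Num.Theory.
Import numFieldNormedType.Exports.
Local Open Scope classical_set_scope.
Local Open Scope ring_scope.
Set Implicit Arguments.
Unset Strict Implicit.

(** * Euclidean geometry and the distance to the complement *)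

Section euclid.
Variables (R : realType) (n : nat).
Implicit Types (u v w x y z : 'rV[R]_n) (a : R).

(** The differential of [near_point] is obtained at each point off the ridge, but its continuity is
    not. The divergence of V is therefore not known to be continuous, and its integral is computed
    as a limit of integrals of difference quotients, which needs only a Lipschitz bound and a
    pointwise derivative. Closedness of the ridge is what gives room: a ridge-free ball of radius
    rho about x lets the ball touching the boundary at N x be enlarged by a factor t > 1 depending
    only on rho and on a bound for delta. Hence the Lipschitz constant t / (t - 1) of N is uniform
    on a compact support. The constant comes from the tangent point c * F, where F = f/delta. After
    integration the lower bound has the density c^(p-1) ((p-1)(1-c) - delta kappa_tilde) |F|^p. The
    factor c^(p-1) (1-c) is largest at c = (p-1)/p, where (p-1)(1-c) = c. The curvatures enter as an
    arbitrary function of x, with no measurability. The term containing them is shown to be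
    integrable by expressing it through the divergence of V. *)

Lemma dotpC u v : dotp u v = dotp v u.
Proof. by apply: eq_bigr => i _; rewrite mulrC. Qed.

Lemma dotpDl u v w : dotp (u + v) w = dotp u w + dotp v w.
Proof. by rewrite /dotp -big_split; apply: eq_bigr => i _; rewrite mxE mulrDl. Qed.

Lemma dotpZl a u w : dotp (a *: u) w = a * dotp u w.
Proof. by rewrite /dotp mulr_sumr; apply: eq_bigr => i _; rewrite mxE mulrA. Qed.

Lemma dotpDr u v w : dotp w (u + v) = dotp w u + dotp w v.
Proof. by rewrite !(dotpC w) dotpDl. Qed.

Lemma dotpZr a u w : dotp w (a *: u) = a * dotp w u.
Proof. by rewrite !(dotpC w) dotpZl. Qed.

Lemma dotpNl u w : dotp (- u) w = - dotp u w.
Proof. by rewrite -scaleN1r dotpZl mulN1r. Qed.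

Lemma dotpNr u w : dotp w (- u) = - dotp w u.
Proof. by rewrite !(dotpC w) dotpNl. Qed.

Lemma dotp0l w : dotp 0 w = 0.
Proof. by rewrite -(scale0r w) dotpZl mul0r. Qed.

Lemma dotp0r w : dotp w 0 = 0.
Proof. by rewrite dotpC dotp0l. Qed.

Definition dotpE := (dotpDl, dotpDr, dotpNl, dotpNr, dotpZl, dotpZr).

Lemma dotp_delta u i : dotp u (delta_mx ord0 i) = u ord0 i.
Proof.
rewrite /dotp (bigD1 i)//= mxE !eqxx mulr1 big1 ?addr0// => j ji.
by rewrite mxE (negbTE ji) andbF mulr0.
Qed.

Lemma dotp_mul (Q : 'M[R]_n) u v : Q *m Q^T = 1%:M -> dotp (u *m Q) (v *m Q) = dotp u v.
Proof.
have dE x y : dotp x y = (x *m y^T) ord0 ord0.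
  by rewrite mxE; apply: eq_bigr => i _; rewrite mxE.
by move=> QQ; rewrite !dE trmx_mul mulmxA -(mulmxA u) QQ mulmx1.
Qed.

Lemma dotp_ge0 u : 0 <= dotp u u.
Proof. by apply: sumr_ge0 => i _; rewrite -expr2 sqr_ge0. Qed.

Lemma dotp_eq0 u : dotp u u = 0 -> u = 0.
Proof.
move=> /psumr_eq0P h; apply/rowP => i; rewrite mxE; apply/eqP.
have := h _ i isT; rewrite -expr2 => /(_ _)/eqP; rewrite sqrf_eq0; apply.
by move=> j _; rewrite -expr2 sqr_ge0.
Qed.

Lemma enorm_ge0 u : 0 <= enorm u. Proof. exact: sqrtr_ge0. Qed.

Lemma enorm_sqr u : enorm u ^+ 2 = dotp u u.
Proof. by rewrite sqr_sqrtr// dotp_ge0. Qed.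

Lemma enorm_eq0 u : enorm u = 0 -> u = 0.
Proof. by move=> u0; apply: dotp_eq0; rewrite -enorm_sqr u0 expr0n. Qed.

Lemma enorm_gt0 u : u != 0 -> 0 < enorm u.
Proof. by move=> u0; rewrite lt_def enorm_ge0 andbT; apply: contra_neq u0 => /enorm_eq0.
  Qed.

Lemma enormN u : enorm (- u) = enorm u.
Proof. by rewrite /enorm dotpNl dotpNr opprK. Qed.

Lemma enorm_distC u v : enorm (u - v) = enorm (v - u).
Proof. by rewrite -enormN opprB. Qed.

Lemma enormZ a u : enorm (a *: u) = `|a| * enorm u.
Proof. by rewrite /enorm dotpZl dotpZr mulrA -expr2 sqrtrM ?sqr_ge0// sqrtr_sqr. Qed.

(* Expand [0 <= |a u - b v|^2] with [a = |v|] and [b = |u|]. *)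
Lemma dotp_le u v : dotp u v <= enorm u * enorm v.
Proof.
have [->|u0] := eqVneq u 0; first by rewrite dotp0l mulr_ge0// enorm_ge0.
have [->|v0] := eqVneq v 0; first by rewrite dotp0r mulr_ge0// enorm_ge0.
have := dotp_ge0 (enorm v *: u - enorm u *: v).
rewrite !dotpE -(enorm_sqr u) -(enorm_sqr v) (dotpC v u).
have := enorm_gt0 u0; have := enorm_gt0 v0; set a := enorm u; set b := enorm v.
move=> b0 a0 h; have : 0 <= (2 * a * b) * (a * b - dotp u v) by lra.
by rewrite pmulr_rge0 ?subr_ge0// !mulr_gt0.
Qed.

Lemma enormD u v : enorm (u + v) <= enorm u + enorm v.
Proof.
rewrite -(@ler_pXn2r _ 2)// ?nnegrE ?addr_ge0 ?enorm_ge0//.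
rewrite enorm_sqr sqrrD !dotpE !enorm_sqr (dotpC v u).
by have := dotp_le u v; lra.
Qed.

Lemma enorm_dist x y z : enorm (x - z) <= enorm (x - y) + enorm (y - z).
Proof. by rewrite -[x - z](subrKA y); exact: enormD. Qed.

Lemma dotp_le_enorm u v : enorm u <= enorm v -> dotp u u <= dotp v v.
Proof. by move=> uv; rewrite -!enorm_sqr ler_pXn2r// nnegrE enorm_ge0. Qed.

Lemma coord_le_norm u i : `|u ord0 i| <= `|u|.
Proof.
rewrite [leRHS]/Num.Def.normr/= mx_normrE.
exact: (le_trans _ (le_bigmax _ _ (ord0, i))).
Qed.

Lemma norm_le_enorm u : `|u| <= enorm u.
Proof.
rewrite [leLHS]/Num.Def.normr/= mx_normrE; apply: bigmax_le => [|[i j] _ /=].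
  exact: enorm_ge0.
rewrite ord1 -sqrtr_sqr ler_sqrt ?dotp_ge0//.
rewrite /dotp (bigD1 j)//= -expr2 lerDl; apply: sumr_ge0 => k _.
by rewrite -expr2 sqr_ge0.
Qed.

Lemma enorm_le_norm u : enorm u <= n%:R * `|u|.
Proof.
rewrite -[leRHS]ger0_norm ?mulr_ge0// -sqrtr_sqr ler_sqrt ?sqr_ge0//.
have [n0|n0] := posnP n.
  by rewrite /dotp big1 ?sqr_ge0// => i; have := ltn_ord i; rewrite [X in (_ < X)%N]n0.
apply: (@le_trans _ _ (\sum_(i < n) `|u| ^+ 2)).
  apply: ler_sum => i _; rewrite -expr2 -real_normK ?num_real//.
  by rewrite ler_pXn2r ?nnegrE// coord_le_norm.
rewrite sumr_const card_ord -[leLHS]mulr_natl exprMn ler_wpM2r ?sqr_ge0//.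
by rewrite -natrX ler_nat -{1}(expn1 n) leq_pexp2l.
Qed.

Lemma differentiable_dotp (V : normedModType R) (f g : V -> 'rV[R]_n) (a : V) :
  differentiable f a -> differentiable g a ->
  differentiable (fun b => dotp (f b) (g b)) a.
Proof.
move=> df dg; rewrite (_ : (fun _ => _) = \sum_(i < n)
  (fun b => f b ord0 i * g b ord0 i)); last first.
  by apply/funext => b; rewrite fct_sumE.
apply: differentiable_sum => i; apply: differentiableM.
  exact: (differentiable_comp df (differentiable_coord _ _ _)).
exact: (differentiable_comp dg (differentiable_coord _ _ _)).
Qed.

Lemma continuous_enorm : continuous (@enorm R n).
Proof.
move=> x; apply: (@continuous_comp _ _ _ (fun u : 'rV[R]_n => dotp u u) Num.sqrt);
  last first.
  exact: sqrt_continuous.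
exact/differentiable_continuous/differentiable_dotp.
Qed.

End euclid.
Arguments dotpE {R n}.

Section distance.
Variables (R : realType) (n : nat) (Omega : set 'rV[R]_n).
Hypotheses (Omega_open : open Omega) (Omega_nT : ~` Omega !=set0).
Implicit Types (x y z : 'rV[R]_n) (t : R).
Local Notation delta := (delta Omega).
Local Notation near_points := (near_points Omega).
Local Notation ridge := (ridge Omega).
Local Notation boundary := (boundary Omega).

Lemma delta_has_inf x : has_inf [set enorm (z - x) | z in ~` Omega].
Proof.
split; first by have [z zO] := Omega_nT; exists (enorm (z - x)), z.
by exists 0 => _ [z _ <-]; exact: enorm_ge0.
Qed.

Lemma delta_le x z : ~ Omega z -> delta x <= enorm (z - x).
Proof.
move=> zO; apply: ge_inf; first by have [] := delta_has_inf x.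
by exists z.
Qed.

Lemma delta_ge0 x : 0 <= delta x.
Proof. by apply: lb_le_inf => [|_ [z _ <-]];
  [have [] := delta_has_inf x|exact: enorm_ge0]. Qed.

Lemma le_delta x a : (forall z, ~ Omega z -> a <= enorm (z - x)) -> a <= delta x.
Proof.
by move=> h; apply: lb_le_inf => [|_ [z zO <-]]; [have [] := delta_has_inf x|exact: h].
Qed.

Lemma delta_lip x y : delta x <= delta y + enorm (x - y).
Proof.
rewrite -lerBlDr; apply: le_delta => z zO; rewrite lerBlDr.
by rewrite (le_trans (delta_le x zO))// (le_trans (enorm_dist z y x))// (enorm_distC y x).
Qed.

Lemma boundary_notin y : boundary y -> ~ Omega y.
Proof. by move=> [_]; rewrite (interior_id _).1. Qed.

Lemma closest_point x : exists2 y, ~ Omega y & enorm (y - x) = delta x.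
Proof.
have [z0 z0O] := Omega_nT.
(* Points of the complement outside [K] are farther from [x] than [z0], so minimising over the
   compact set [K] is enough. *)
pose K := ~` Omega `&` [set z | enorm (z - x) <= enorm (z0 - x)].
have cf : continuous (fun z => enorm (z - x)).
  move=> z; apply: (@continuous_comp _ _ _ (fun z => z - x) (@enorm R n)).
      have df : differentiable (fun z : 'rV[R]_n => z - x) z by apply: differentiableB.
    exact: differentiable_continuous df.
  exact: continuous_enorm.
have cK : compact K.
  apply: bounded_closed_compact.
    exists (enorm (z0 - x) + `|x|); split; first exact: num_real.
    move=> M ltM z [_ /= zz0]; rewrite (le_trans _ (ltW ltM))//.
    rewrite -[z](subrK x) (le_trans (ler_normD _ _))// lerD2r.
    exact: le_trans (norm_le_enorm _) zz0.
  apply: closedI; first exact: open_closedC.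
  by apply: (@preimage_closed _ _ (fun z => enorm (z - x)) [set t | t <= enorm (z0 - x)])
    => [z _|];
    [exact: cf | exact: closed_le].
have K0 : K !=set0 by exists z0; split => /=.
have [y] := @EVT_min_rV _ _ (fun z => enorm (z - x)) _ K0 cK (continuous_subspaceT cf).
rewrite inE => -[yO /= yz0] ymin; exists y => //.
apply/eqP; rewrite eq_le delta_le// andbT; apply: le_delta => z zO.
have [zz0|/ltW z0z] := leP (enorm (z - x)) (enorm (z0 - x)); last exact: le_trans z0z.
by apply: ymin; rewrite inE; split.
Qed.

Lemma delta_gt0 x : Omega x -> 0 < delta x.
Proof.
move=> xO; rewrite lt_def delta_ge0 andbT; apply/eqP => d0.
have [y yO] := closest_point x; rewrite d0 => /enorm_eq0 /subr0_eq yx.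
by apply: yO; rewrite yx.
Qed.

Lemma closest_boundary x y : Omega x -> ~ Omega y -> enorm (y - x) = delta x -> boundary y.
Proof.
move=> xO yO yx; split; last by rewrite (interior_id _).1.
(* These points are at distance (1 - t) delta x < delta x from [x]. Letting t tend to 0 puts [y] in
   the closure of [Omega]. *)
have inO t : 0 < t -> t <= 1 -> Omega (y + t *: (x - y)).
  move=> t0 t1; apply: contrapT => tO; have := delta_le x tO.
  rewrite (_ : _ - x = (1 - t) *: (y - x)); last by apply/rowP => i; rewrite !mxE; ring.
  rewrite enormZ yx ger0_norm ?subr_ge0// => h.
  by have := delta_gt0 xO; nra.
move=> B /nbhs_ballP[e /= e0 eB].
have d0 : 0 < `|x - y| + 1 by rewrite ltr_wpDl.
pose t := Num.min 1 (e / (`|x - y| + 1) / 2).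
have t0 : 0 < t by rewrite lt_min ltr01 !divr_gt0.
exists (y + t *: (x - y)); split; first by apply: inO => //; rewrite ge_min lexx.
apply: eB; rewrite -ball_normE /= opprD addNKr normrN normrZ gtr0_norm//.
have tle : t <= e / (`|x - y| + 1) / 2 by rewrite ge_min lexx orbT.
rewrite (@le_lt_trans _ _ (e / (`|x - y| + 1) / 2 * (`|x - y| + 1)))//.
  by apply: ler_pM => //; [exact: ltW|rewrite lerDl].
by rewrite mulrAC divfK ?gt_eqF//; lra.
Qed.

Lemma near_point_exists x : Omega x -> near_points x !=set0.
Proof.
move=> xO; have [y yO yx] := closest_point x; exists y; split => //.
exact: closest_boundary xO yO yx.
Qed.

Lemma near_point_min x y z : near_points x y -> ~ Omega z -> enorm (y - x) <= enorm (z - x).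
Proof. by move=> [_ ->] ?; exact: delta_le. Qed.

(** By the triangle inequality, the ball centred at parameter [s] and touching at [y] lies inside
    the one centred at parameter [t]. *)
Lemma near_point_segment x y (s t : R) : near_points (y + t *: (x - y)) y ->
  0 <= s <= t -> near_points (y + s *: (x - y)) y.
Proof.
move=> hN /andP[s0 st]; have [yb _] := hN; split => //.
apply/eqP; rewrite eq_le delta_le ?andbT; last exact: boundary_notin.
apply: le_delta => z zO; have := near_point_min hN zO.
have -> : y - (y + t *: (x - y)) = (- t) *: (x - y) by apply/rowP => i; rewrite !mxE; ring.
have -> : y - (y + s *: (x - y)) = (- s) *: (x - y) by apply/rowP => i; rewrite !mxE; ring.
rewrite !enormZ !normrN !ger0_norm//; last exact: le_trans st.
move=> h1; have := enorm_dist z (y + s *: (x - y)) (y + t *: (x - y)).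
have -> : y + s *: (x - y) - (y + t *: (x - y)) = (s - t) *: (x - y) by apply/rowP => i;
  rewrite !mxE; ring.
by rewrite enormZ ler0_norm ?subr_le0//; lra.
Qed.

(* The ball centred at [y + t (x - y)] that touches the boundary at [y] contains no
   point outside [Omega]. *)
Lemma near_point_ball x y z t : near_points (y + t *: (x - y)) y -> ~ Omega z ->
  2 * t * dotp (x - y) (z - y) <= dotp (z - y) (z - y).
Proof.
move=> hN zO; have /dotp_le_enorm := near_point_min hN zO.
have -> : y - (y + t *: (x - y)) = (- t) *: (x - y) by apply/rowP => i; rewrite !mxE; ring.
have -> : z - (y + t *: (x - y)) = (z - y) - t *: (x - y) by apply/rowP => i;
  rewrite !mxE; ring.
move: (z - y) (x - y) => e d; rewrite !dotpE (dotpC e d); lra.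
Qed.

(* Add [near_point_ball] for the pair [(y, y')] to the one for [(y', y)]. *)
Lemma near_point_lip x x' y y' t : 1 < t ->
  near_points (y + t *: (x - y)) y -> near_points (y' + t *: (x' - y')) y' ->
  enorm (y' - y) <= t / (t - 1) * enorm (x' - x).
Proof.
move=> t1 hy hy'; have [yb _] := hy; have [yb' _] := hy'.
have := near_point_ball hy (boundary_notin yb').
have := near_point_ball hy' (boundary_notin yb).
have -> : x' - y' = (x' - x) + (x - y) - (y' - y) by apply/rowP => i; rewrite !mxE; ring.
have -> : y - y' = - (y' - y) by rewrite opprB.
move: (dotp_le (x' - x) (y' - y)).
move: (y' - y) (x - y) (x' - x) => e d h; rewrite !dotpE -(enorm_sqr e).
have := enorm_ge0 e; have := enorm_ge0 h.
set E := enorm e; set H := enorm h => H0 E0 CS h1 h2.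
rewrite mulrAC ler_pdivlMr ?subr_gt0//.
(* The terms in [d] cancel in the sum of the two ball inequalities. Cauchy-Schwarz and division by
   [E] then give the factor t / (t - 1). *)
have h3 : (t - 1) * E ^+ 2 <= t * dotp h e by lra.
have [->|Ene] := eqVneq E 0; first by rewrite mul0r mulr_ge0//; lra.
have {Ene}E0' : 0 < E by rewrite lt_def Ene.
rewrite -(ler_pM2r E0'); have : t * dotp h e <= t * (H * E) by rewrite ler_pM2l//; lra.
by lra.
Qed.

(** If the supremum S of the admissible parameters is finite, it yields a ridge point at distance (S
    - 1) delta x from [x], so (S - 1) delta x is at least [rho]. The factor 2 keeps the claimed
    parameter strictly below S, so that some admissible parameter lies beyond it and
    [near_point_segment] applies. *)
Lemma near_point_extends rho x y : 0 < rho -> Omega x ->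
  near_points x y -> (forall z, `|z - x| < rho -> ~ ridge z) ->
  near_points (y + (1 + rho / (2 * delta x)) *: (x - y)) y.
Proof.
move=> rho0 xO hy hR; have d0 := delta_gt0 xO.
have S1 : ridge_times Omega x y 1 by split => //=; rewrite scale1r addrC subrK.
set t := 1 + _.
have t0 : 1 < t by rewrite ltrDl divr_gt0// mulr_gt0.
suff [s [s0 hs] ts] : exists2 s, ridge_times Omega x y s & t <= s.
  by apply: near_point_segment hs _; rewrite ts andbT; lra.
have [ub|nub] := pselect (has_ubound (ridge_times Omega x y)); last first.
  apply: contrapT => h; apply: nub; exists t => s hs; rewrite leNgt.
  by apply/negP => /ltW ts; apply: h; exists s.
set S := sup (ridge_times Omega x y).
have hS : has_sup (ridge_times Omega x y) by split => //; exists 1.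
have S1' : 1 <= S by exact: ub_le_sup.
have : ridge (y + S *: (x - y)) by exists x, y.
move=> rS; have /negP : ~ (`|y + S *: (x - y) - x| < rho) by move=> /hR; apply.
rewrite -leNgt (_ : _ - x = (S - 1) *: (x - y)); last by apply/rowP => i; rewrite !mxE;
  ring.
rewrite normrZ ger0_norm ?subr_ge0// => rS'.
have {}rS' : rho <= (S - 1) * delta x.
  apply: (le_trans rS'); rewrite ler_wpM2l ?subr_ge0//.
  by have [_ <-] := hy; rewrite (le_trans (norm_le_enorm _))// enorm_distC.
have tS : t < S.
  rewrite /t -ltrBrDl ltr_pdivrMr ?mulr_gt0//; nra.
have [s hs sS] := @sup_adherent _ _ (S - t) ltac:(by rewrite subr_gt0) hS.
by exists s => //; rewrite ltW//; move: sS; rewrite subKr.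
Qed.

End distance.

(** * Differentiability *)

Section frechet.
Variables (R : realType).

Lemma differentiable_eps (V W : normedModType R) (f : V -> W) x (e : R) :
  differentiable f x -> 0 < e ->
  exists2 r, 0 < r & forall h, `|h| < r -> `|f (h + x) - f x - 'd f x h| <= e * `|h|.
Proof.
move=> /diff_locally /eqaddoP /(_ e) + e0 => /(_ e0).
move=> /nbhs_ballP[r /= r0 rh]; exists r => // h hr.
have := rh h; rewrite -ball_normE /= sub0r normrN => /(_ hr).
by rewrite opprD !fctE addrA.
Qed.

Lemma differentiable_intro (V W : normedModType R) (f : V -> W) x (L : {linear V -> W}) :
  continuous L ->
  (forall e, 0 < e -> exists2 r, 0 < r &
     forall h, `|h| < r -> `|f (h + x) - f x - L h| <= e * `|h|) ->
  differentiable f x /\ 'd f x = L :> (V -> W).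
Proof.
move=> cL hL.
have dE : 'd f x = L :> (V -> W).
  apply: diff_unique => //; apply/eqaddoP => e e0.
  have [r r0 rh] := hL e e0; apply/nbhs_ballP; exists r => //= h.
  rewrite -ball_normE /= sub0r normrN => /rh.
  by rewrite !fctE opprD addrA.
split => //; apply/diff_locallyP; rewrite dE; split => //.
apply/eqaddoP => e e0.
have [r r0 rh] := hL e e0; apply/nbhs_ballP; exists r => //= h.
rewrite -ball_normE /= sub0r normrN => /rh.
by rewrite !fctE opprD addrA.
Qed.

Lemma mulmx_norm_le m n (u : 'rV[R]_m) (B : 'M[R]_(m, n)) :
  `|u *m B| <= m%:R * `|B| * `|u|.
Proof.
rewrite [leLHS]/Num.Def.normr/= mx_normrE; apply: bigmax_le => [|[i j] _ /=].
  by rewrite !mulr_ge0.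
rewrite mxE (le_trans (ler_norm_sum _ _ _))// -mulrA mulr_natl -[X in _ *+ X]card_ord
  -sumr_const.
apply: ler_sum => k _; rewrite normrM mulrC ler_pM//.
  rewrite [leRHS]/Num.Def.normr/= mx_normrE.
  exact: (le_trans _ (le_bigmax _ _ (k, j))).
by rewrite ord1 coord_le_norm.
Qed.

Lemma differentiable_rV (V : normedModType R) n (f : V -> 'rV[R]_n) x :
  (forall i, differentiable (fun y => f y ord0 i) x) -> differentiable f x.
Proof.
move=> df; rewrite (_ : f = \sum_(i < n)
  (fun y => f y ord0 i *: (delta_mx ord0 i : 'rV[R]_n))).
  by apply: differentiable_sum => i; exact: differentiableZl.
by apply/funext => y; rewrite fct_sumE [LHS]row_sum_delta.
Qed.

Lemma continuous_mulmxr m n (B : 'M[R]_(m, n)) : continuous (@mulmxr R 1 m n B).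
Proof.
move=> x; apply/differentiable_continuous/differentiable_rV => j.
rewrite (_ : (fun _ => _) = \sum_(k < m) (fun u : 'rV[R]_m => B k j *: u ord0 k)).
  by apply: differentiable_sum => k; apply: differentiableZ; exact: differentiable_coord.
by apply/funext => u; rewrite fct_sumE mxE; apply: eq_bigr => k _; rewrite mulrC.
Qed.

Lemma linear_mulmxrE m n (L : {linear 'rV[R]_m -> 'rV[R]_n}) u :
  L u = u *m lin1_mx L.
Proof. by rewrite mul_rV_lin1. Qed.

Section line.
Variables (V W : normedModType R) (f : V -> W) (v b : V).

Lemma is_derive_line (s : R) : derivable f (s *: v + b) v ->
  is_derive s 1 (fun t : R => f (t *: v + b)) ('D_v f (s *: v + b)).
Proof.
move=> df.
have E : (fun h : R => h^-1 *:
  (((fun t : R => f (t *: v + b)) \o shift s) (h *: (1 : R)) - f (s *: v + b)))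
  = (fun h : R => h^-1 *: ((f \o shift (s *: v + b)) (h *: v) - f (s *: v + b))).
  by apply/funext => h /=; rewrite /shift /= [h *: 1]mulr1 scalerDl addrA.
by apply: DeriveDef; rewrite /derivable /derive E.
Qed.

End line.

Lemma mvt_line (V : normedModType R) (f : V -> R) (v b : V) (c : R) :
  (forall s : R, `|s| <= `|c| -> derivable f (s *: v + b) v) ->
  exists2 s : R, `|s| <= `|c| & f (c *: v + b) - f b = c * 'D_v f (s *: v + b).
Proof.
move=> df; pose g (t : R) := f (t *: v + b).
pose dg (t : R) : R := 'D_v f (t *: v + b).
have dgP (s : R) : `|s| <= `|c| -> is_derive s 1 g (dg s).
  by move=> sc; apply: is_derive_line; exact: df.
have cg (x y : R) : (forall s, s \in `[x, y] -> `|s| <= `|c|) -> {within `[x, y],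
  continuous g}.
  move=> h; apply: derivable_within_continuous => s /h sc.
  by have := dgP s sc; case.
have g0 : g 0 = f b by rewrite /g scale0r add0r.
rewrite -g0 -/(g c); have [c0|c0] := leP 0 c.
  have hs s : s \in `[0, c] -> `|s| <= `|c|.
    by rewrite in_itv /= => /andP[s0 sc]; rewrite !ger0_norm.
  have [s sc ->] := @MVT_segment _ g dg 0 c c0
    (fun s h => dgP s (hs s (subset_itv_oo_cc h))) (cg _ _ hs).
  by exists s; [exact: hs|rewrite subr0 mulrC].
have hs s : s \in `[c, 0] -> `|s| <= `|c|.
  by rewrite in_itv /= => /andP[s0 sc]; rewrite !ler0_norm// ?lerN2// ltW.
have [s sc h] := @MVT_segment _ g dg c 0 (ltW c0)
  (fun s h => dgP s (hs s (subset_itv_oo_cc h))) (cg _ _ hs).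
by exists s; [exact: hs|rewrite -[LHS]opprB h sub0r mulrN opprK mulrC].
Qed.

(** The increment of [f] is split into steps parallel to the axes, and the mean value theorem on
    each step compares it with the partial derivative at [a]. *)
Lemma differentiable_C1 m (V : set 'rV[R]_m) (f : 'rV[R]_m -> R) (a : 'rV[R]_m) :
  open V -> Ck_on V 1 f -> V a -> differentiable f a.
Proof.
move=> oV [_ Cf] Va.
pose d := \col_i 'D_(delta_mx ord0 i) f a.
have Lscal : scalar (fun h : 'rV[R]_m => (h *m d) ord0 ord0).
  by move=> k u v; rewrite mulmxDl -scalemxAl !mxE.
pose L : {linear 'rV[R]_m -> R^o} := HB.pack (fun h : 'rV[R]_m => (h *m d) ord0 ord0)
  (GRing.isLinear.Build _ _ _ _ _ Lscal).
apply: (proj1 (@differentiable_intro _ _ f a L _ _)).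
  move=> x; apply: (@continuous_comp _ _ _ (@mulmxr R 1 m 1 d)
    (fun M : 'M[R]_1 => M ord0 ord0)).
    exact: continuous_mulmxr.
  exact: coord_continuous.
move=> e e0; set e' := e / (m%:R + 1).
have e'0 : 0 < e' by rewrite divr_gt0// ltr_wpDl.
have : \forall b \near a, V b /\
    forall i, `|'D_(delta_mx ord0 i) f a - 'D_(delta_mx ord0 i) f b| <= e'.
  apply: filterI; first exact: open_nbhs_nbhs.
  apply: (@filter_forall _ _ _ _ (nbhs_filter a)) => i; have [_ [+ _]] := Cf i.
  by move=> /(_ _ Va) /cvgrPdist_le /(_ _ e'0).
move=> /nbhs_ballP[r /= r0 rh]; exists r => // h hr.
(* [p k] keeps the first [k] coordinates of [h]. All intermediate points stay in the ball, since the
   norm is the sup norm. *)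
pose p k : 'rV[R]_m := \row_i (if (i < k)%N then h ord0 i else 0).
have pS (k : 'I_m) : p k.+1 = h ord0 k *: delta_mx ord0 k + p k.
  apply/rowP => i; rewrite !mxE eqxx /= eq_sym ltnS leq_eqVlt.
  have [->|ik] := eqVneq k i; first by rewrite eqxx ltnn mulr1 addr0.
  by rewrite eq_sym (inj_eq val_inj) (negbTE ik) /= mulr0 add0r.
have p0 : p 0%N = 0 by apply/rowP => i; rewrite !mxE.
have pm : p m = h by apply/rowP => i; rewrite !mxE ltn_ord.
have pin k (s : R) : `|s| <= `|h ord0 k| -> ball a r (s *: delta_mx ord0 k + (p k + a)).
  move=> sh; rewrite -ball_normE /= addrA opprD addrCA subrr addr0 normrN
    (le_lt_trans _ hr)//.
  rewrite [leLHS]/Num.Def.normr/= mx_normrE; apply: bigmax_le => // -[i j] _ /=.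
  have -> : i = ord0 by exact: ord1.
  rewrite !mxE eqxx /=; have [->|jk] := eqVneq j k.
    by rewrite ltnn mulr1 addr0 (le_trans sh)// coord_le_norm.
  by rewrite mulr0 add0r; case: ifP => _; rewrite ?normr0// coord_le_norm.
have step (k : 'I_m) :
  `|f (p k.+1 + a) - f (p k + a) - h ord0 k * d k ord0| <= e' * `|h|.
  have [|s sh E] := @mvt_line _ f (delta_mx ord0 k) (p k + a) (h ord0 k).
    by move=> s /pin /rh [Vs _]; exact: (Cf k).1.
  rewrite pS -(addrA (h ord0 k *: _)) E -mulrBr mxE normrM mulrC ler_pM//;
    last exact: coord_le_norm.
  by rewrite distrC; apply: (rh _ (pin _ _ sh)).2.
have -> : f (h + a) - f a = \sum_(k < m) (f (p k.+1 + a) - f (p k + a)).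
  rewrite -(big_mkord xpredT (fun k => f (p k.+1 + a) - f (p k + a))).
  by rewrite telescope_sumr// pm p0 add0r.
rewrite /= mxE -sumrB (le_trans (ler_norm_sum _ _ _))//.
apply: (@le_trans _ _ (\sum_(k < m) e' * `|h|)); first by apply: ler_sum => k _;
  exact: step.
rewrite sumr_const card_ord -mulr_natl mulrA ler_wpM2r// /e' mulrCA ler_piMr//;
  first exact: ltW.
by rewrite ler_pdivrMr ?mul1r ?lerDl// ltr_wpDl.
Qed.

(* [P (U y) = y] with [U] Lipschitz forces the range of the differential of [P]
   to be dense, so that this differential is invertible: no second-order condition
   is needed to exclude focal points. *)
Lemma differentiable_right_inverse n (P U : 'rV[R]_n -> 'rV[R]_n) x (C : R) :
  differentiable P (U x) ->
  (\forall y \near x, P (U y) = y /\ `|U y - U x| <= C * `|y - x|) ->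
  differentiable U x /\ forall k, 'd U x ('d P (U x) k) = k.
Proof.
move=> dP near_x; set A := lin1_mx ('d P (U x)).
have [PUx _] := nbhs_singleton near_x.
have dPE k : 'd P (U x) k = k *m A by rewrite linear_mulmxrE.
pose C' := `|C| + 1; have C'0 : 0 < C' by rewrite ltr_wpDl.
(* First-order expansion of P (U (h + x)) = h + x. The Lipschitz bound turns an error small in
   [U (h + x) - U x] into one small in [h]. *)
have key e : 0 < e -> exists2 r, 0 < r & forall h, `|h| < r ->
    `|h - (U (h + x) - U x) *m A| <= e * `|h|.
  move=> e0; have [r r0 rP] := differentiable_eps dP (divr_gt0 e0 C'0).
  move: near_x => /nbhs_ballP[q /= q0 qh].
  exists (Num.min q (r / C')); first by rewrite lt_min q0 divr_gt0.
  move=> h; rewrite lt_min => /andP[hq hr].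
  have [|PU UL] := qh (h + x).
    by rewrite -ball_normE /= opprD addrCA subrr addr0 normrN.
  have {}UL : `|U (h + x) - U x| <= C' * `|h|.
    by move: UL; rewrite addrK => /le_trans; apply;
      rewrite ler_wpM2r// (le_trans (ler_norm _))// lerDl.
  have /rP : `|U (h + x) - U x| < r.
    by rewrite (le_lt_trans UL)// mulrC -ltr_pdivlMr.
  rewrite subrK PU PUx addrK dPE => /le_trans; apply.
  apply: (le_trans (ler_wpM2l _ UL)); first exact/ltW/divr_gt0.
  by rewrite mulrA divfK ?gt_eqF.
have Au : A \in unitmx.
  rewrite -unitmx_tr -row_free_unit -kermx_eq0; apply/rowV0P => w /sub_kermxP wA.
  apply/eqP/negPn/negP => w0; have w0' : 0 < `|w| by rewrite normr_gt0.
  have ww : 0 < dotp w w by rewrite -enorm_sqr exprn_gt0// enorm_gt0.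
  (* For [w] orthogonal to the range of [A], pairing [key] at h = s w with [w] leaves s |w|^2 on the
     left. This [e] makes the right side at most half of it; the added 1 only guards the
     denominator. *)
  pose e := dotp w w / (n%:R * `|w| * `|w| + 1) / 2.
  have den0 : 0 < n%:R * `|w| * `|w| + 1 by rewrite ltr_wpDl// !mulr_ge0.
  have e0 : 0 < e by rewrite !divr_gt0.
  have [r r0 rh] := key e e0.
  pose s := r / `|w| / 2; have s0 : 0 < s by rewrite !divr_gt0.
  have hs : `|s *: w| < r.
    rewrite normrZ gtr0_norm// /s mulrAC divfK ?gt_eqF//; lra.
  have := rh _ hs; set Ud := U _ - _ => h1.
  have h2 : `|(s *: w - Ud *m A) *m w^T| <= n%:R * `|w^T| * (e * `|s *: w|).
    by rewrite (le_trans (mulmx_norm_le _ _))// ler_wpM2l// mulr_ge0.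
  have h3 : (s *: w - Ud *m A) *m w^T = (s * dotp w w)%:M.
    have AwT : A *m w^T = 0 by rewrite -[A]trmxK -trmx_mul wA trmx0.
    rewrite mulmxBl -mulmxA AwT mulmx0 subr0 -scalemxAl.
    apply/matrixP => i j; rewrite !ord1 !mxE eqxx mulr1n; congr (_ * _).
    by apply: eq_bigr => k _; rewrite mxE.
  have h4 : s * dotp w w <= n%:R * `|w^T| * (e * `|s *: w|).
    apply: le_trans h2; rewrite h3 (le_trans _ (coord_le_norm _ ord0))//.
    by rewrite mxE eqxx mulr1n ler_norm.
  have wT : `|w^T| <= `|w|.
    rewrite [leLHS]/Num.Def.normr/= mx_normrE; apply: bigmax_le => // -[i j] _ /=.
    by rewrite mxE ord1 coord_le_norm.
  have : s * dotp w w <= s * (n%:R * `|w| * `|w| * e).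
    apply: (le_trans h4); rewrite normrZ (gtr0_norm s0).
    rewrite (_ : s * _ = n%:R * `|w| * (e * (s * `|w|))); last by ring.
    apply: ler_wpM2r; first by rewrite !mulr_ge0// ltW.
    exact: ler_wpM2l.
  rewrite ler_pM2l// => h5; have : dotp w w <= dotp w w / 2.
    apply: (le_trans h5); rewrite /e; rewrite mulrA ler_wpM2r ?invr_ge0//.
    by rewrite mulrA ler_pdivrMr// mulrDr mulr1 [leLHS]mulrC lerDl ltW.
  by move: ww; lra.
pose B := invmx A; pose L : {linear 'rV[R]_n -> 'rV[R]_n} := @mulmxr R 1 n n B.
have [|dU dUE] := @differentiable_intro _ _ U x L (@continuous_mulmxr _ _ B).
  move=> e e0; set c := n%:R * `|B| + 1.
  have c0 : 0 < c by rewrite ltr_wpDl// mulr_ge0.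
  have [r r0 rh] := key (e / c) (divr_gt0 e0 c0); exists r => // h /rh hh.
  rewrite (_ : _ - L h = - ((h - (U (h + x) - U x) *m A) *m B)); last first.
    by rewrite mulmxBl mulmxK// opprB.
  rewrite normrN (le_trans (mulmx_norm_le _ _))//.
  apply: (@le_trans _ _ (c * (e / c * `|h|))).
    by rewrite ler_pM// ?mulr_ge0// /c lerDl.
  by rewrite mulrA (mulrC c) divfK ?gt_eqF.
split; first exact: dU.
move=> k; have dUE' z : 'd U x z = L z by rewrite dUE.
by rewrite -[RHS](mulmxK Au k); exact: (etrans (dUE' _) (congr1 L (dPE k))).
Qed.

End frechet.

Section curves.
Variables (R : realType) (V : normedModType R).

Lemma is_derive_coord n (f : V -> 'rV[R]_n) x v (df : 'rV[R]_n) i :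
  is_derive x v f df -> is_derive x v (fun y => f y ord0 i : R) (df ord0 i).
Proof.
move=> [dfx <-]; have /derivable_mxP h := dfx.
by apply: DeriveDef; [exact: h|rewrite (derive_mx dfx) mxE].
Qed.

Lemma is_derive_rV n (f : V -> 'rV[R]_n) x v (df : 'rV[R]_n) :
  (forall i, is_derive x v (fun y => f y ord0 i : R) (df ord0 i)) -> is_derive x v f df.
Proof.
move=> h; have dfx : derivable f x v.
  by apply/derivable_mxP => i j; rewrite ord1; case: (h j).
apply: DeriveDef => //; rewrite (derive_mx dfx); apply/rowP => i; rewrite mxE.
by case: (h i).
Qed.

Lemma is_derive_mulmx n m (f : V -> 'rV[R]_n) (B : 'M[R]_(n, m)) x v (df : 'rV[R]_n) :
  is_derive x v f df -> is_derive x v (fun y => f y *m B) (df *m B).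
Proof.
move=> h; apply: is_derive_rV => i.
rewrite (_ : (fun _ => _) = \sum_(k < n) (fun y => B k i *: (f y ord0 k : R))); last first.
  by apply/funext => y; rewrite fct_sumE mxE; apply: eq_bigr => k _; rewrite mulrC.
rewrite (_ : _ ord0 i = \sum_(k < n) B k i *: (df ord0 k : R)); last first.
  by rewrite mxE; apply: eq_bigr => k _; rewrite mulrC.
by apply: is_derive_sum => k; apply: is_deriveZ; exact: is_derive_coord.
Qed.

Lemma is_derive_dotp n (f g : V -> 'rV[R]_n) x v (df dg : 'rV[R]_n) :
  is_derive x v f df -> is_derive x v g dg ->
  is_derive x v (fun y => dotp (f y) (g y)) (dotp df (g x) + dotp (f x) dg).
Proof.
move=> hf hg.
rewrite (_ : (fun _ => _) = \sum_(k < n) (fun y => (f y ord0 k : R) * (g y ord0 k : R)));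
  last first.
  by apply/funext => y; rewrite fct_sumE.
rewrite (_ : dotp df _ + _ = \sum_(k < n)
  (f x ord0 k *: (dg ord0 k : R) + g x ord0 k *: (df ord0 k : R))); last first.
  by rewrite -big_split /=; apply: eq_bigr => k _; rewrite addrC (mulrC (df _ _)).
by apply: is_derive_sum => k; apply: is_deriveM; exact: is_derive_coord.
Qed.

Lemma is_derive_scaler n (a : V -> R) (g : V -> 'rV[R]_n) x v da (dg : 'rV[R]_n) :
  is_derive x v a da -> is_derive x v g dg ->
  is_derive x v (fun y => a y *: g y) (da *: g x + a x *: dg).
Proof.
move=> ha hg; apply: is_derive_rV => i.
rewrite (_ : (fun _ => _) = (fun y => a y * (g y ord0 i : R))); last first.
  by apply/funext => y; rewrite mxE.
have := is_deriveM ha (is_derive_coord i hg).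
by move=> h; apply: is_derive_eq h _; rewrite !mxE addrC [g x ord0 i *: _]mulrC.
Qed.

Lemma near_eq_differentiable (W : normedModType R) (f g : V -> W) x :
  (\near x, f x = g x) -> differentiable g x -> differentiable f x.
Proof.
move=> fg dg; have [||//] := @differentiable_intro _ _ _ f x ('d g x);
  first exact: diff_continuous.
move=> e e0; have [r r0 rg] := differentiable_eps dg e0.
have fgx := nbhs_singleton fg.
move: fg => /nbhs_ballP[q /= q0 qfg].
exists (Num.min r q); first by rewrite lt_min r0 q0.
move=> h; rewrite lt_min => /andP[hr hq].
rewrite fgx qfg; first exact: rg.
by rewrite -ball_normE /= opprD addrCA subrr addr0 normrN.
Qed.

End curves.

Lemma local_max_derive0 (R : realType) (h : R -> R) c :
  is_derive (0 : R) 1 h c -> h 0 = 0 -> (\forall s \near 0, h s <= 0) -> c = 0.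
Proof.
move=> [dh hc] h0 hmax; apply/eqP/negPn/negP => c0.
have dh' : differentiable h 0 by exact/derivable1_diffP.
have c0' : 0 < `|c| / 2 by rewrite divr_gt0// normr_gt0.
have [r r0 rh] := differentiable_eps dh' c0'.
move: hmax => /nbhs_ballP[q /= q0 qh].
have m0 : 0 < Num.min r q by rewrite lt_min r0.
(* With the sign of [c], the linear part of [h s] is |c| |s|, twice the allowed error, which makes
   [h s] positive. *)
pose s := Num.sg c * (Num.min r q / 2).
have sE : `|s| = Num.min r q / 2 by rewrite normrM normr_sg c0 mul1r gtr0_norm// divr_gt0.
have sm : `|s| < Num.min r q by rewrite sE; lra.
have := rh s; rewrite (lt_le_trans sm) ?ge_min ?lexx// => /(_ isT).
have -> : 'd h 0 s = s * c.
  by rewrite -[s in LHS]mulr1 -[s * 1]/(s *: (1 : R)) linearZ /= -deriveE// hc.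
have : h s <= 0.
  by apply: qh; rewrite -ball_normE /= sub0r normrN (lt_le_trans sm)// ge_min lexx orbT.
have -> : s * c = `|s| * `|c|.
  by rewrite sE /s mulrAC -normrEsg mulrC.
rewrite addr0 h0 subr0 => hs; rewrite ler_norml => /andP[+ _].
have : 0 < `|s| by rewrite sE divr_gt0.
have : 0 < `|c| by rewrite normr_gt0.
nra.
Qed.

(** * The near point map off the ridge *)

Section near_point_map.
Variables (R : realType) (n : nat) (Omega : set 'rV[R]_n).
Hypotheses (Omega_open : open Omega) (Omega_nT : ~` Omega !=set0).
Hypothesis ridge_closed : exists2 C : set 'rV[R]_n,
     closed C & ridge Omega = Omega `&` C.
Implicit Types (x y z v w : 'rV[R]_n) (t : R).

(** A choice of near point; [near_point_unique] makes it canonical off the ridge. *)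
Definition near_point x : 'rV[R]_n := xget 0 (near_points Omega x).
Local Notation N := near_point.
Local Notation D := (Omega `\` ridge Omega).

Lemma near_pointP x : Omega x -> near_points Omega x (N x).
Proof.
move=> /(near_point_exists Omega_open Omega_nT)[y xy].
exact: (xgetPex 0 (ex_intro _ y xy)).
Qed.

Lemma open_off_ridge : open D.
Proof.
have [C cC RE] := ridge_closed; rewrite RE.
rewrite (_ : _ `\` _ = Omega `&` ~` C); first by apply: openI => //; exact: closed_openC.
by apply/seteqP; split => x [xO h]; split => //; [move=> xC; exact: h|case].
Qed.

(** Replacing [delta Omega x] by an upper bound [d] gives the same parameter at all points sharing
    [rho] and [d], as [near_point_lip] requires. *)
Lemma near_point_extends_at rho d x : 0 < rho -> ball x rho `<=` D -> delta Omega x <= d ->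
  near_points Omega (N x + (1 + rho / (2 * d)) *: (x - N x)) (N x).
Proof.
move=> rho0 xD dx; have [xO _] : D x by apply: xD; exact: ballxx.
have d0 := delta_gt0 Omega_open Omega_nT xO.
apply: (near_point_segment Omega_open Omega_nT (t := 1 + rho / (2 * delta Omega x))).
  apply: near_point_extends => //; first exact: near_pointP.
  move=> z zx; have [] : D z by apply: xD; rewrite -ball_normE /= distrC.
  by [].
apply/andP; split.
  by rewrite addr_ge0// divr_ge0 ?ltW// mulr_gt0// (lt_le_trans d0).
rewrite lerD2l; apply: ler_wpM2l; first exact: ltW.
by rewrite lef_pV2 ?posrE ?ler_pM2l// mulr_gt0// (lt_le_trans d0).
Qed.

(** Here t / (t - 1) is evaluated at t = 1 + rho / (2 d). The two points may be far apart, and the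
    segment joining them may meet the ridge. *)
Lemma near_point_lip_on rho d x x' : 0 < rho -> 0 < d ->
  ball x rho `<=` D -> ball x' rho `<=` D -> delta Omega x <= d -> delta Omega x' <= d ->
  enorm (N x' - N x) <= (1 + 2 * d / rho) * enorm (x' - x).
Proof.
move=> rho0 d0 xD x'D dx dx'.
have e0 : 0 < rho / (2 * d) by rewrite divr_gt0// mulr_gt0.
have := near_point_lip Omega_open Omega_nT _ (near_point_extends_at rho0 xD dx)
  (near_point_extends_at rho0 x'D dx').
rewrite ltrDl => /(_ e0); set e := rho / (2 * d) in e0 *.
rewrite (_ : (1 + e) / _ = 1 + 2 * d / rho)//.
have -> : 2 * d / rho = e^-1 by rewrite invf_div.
by rewrite addrAC subrr add0r mulrDl mul1r divff ?gt_eqF// addrC.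
Qed.

(** The enlarged ball touching at [N x] contains the closed ball of radius delta x about [x], and
    their spheres meet only at [N x]. Any other near point would lie inside the enlarged ball. *)
Lemma near_point_unique x y : D x -> near_points Omega x y -> N x = y.
Proof.
move=> xD xy; have /nbhs_ballP[rho /= rho0 rD] := open_nbhs_nbhs (conj open_off_ridge xD).
have := near_point_extends_at rho0 rD (lexx _).
set t := 1 + _ => hN; have [yb dy] := xy; have [_ dN] := near_pointP xD.1.
have t1 : 1 < t.
  by rewrite ltrDl divr_gt0// mulr_gt0// (delta_gt0 Omega_open Omega_nT xD.1).
have := near_point_ball Omega_nT hN (boundary_notin Omega_open yb).
have : dotp (x - y) (x - y) = dotp (x - N x) (x - N x).
  by rewrite -!enorm_sqr (enorm_distC x y) (enorm_distC x (N x)) dy dN.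
have -> : x - y = (x - N x) - (y - N x) by rewrite opprB addrA subrK.
move=> h1 h2; have key (a b : 'rV[R]_n) : dotp (a - b) (a - b) = dotp a a ->
  2 * t * dotp a b <= dotp b b -> dotp b b <= 0.
  by rewrite !dotpE (dotpC b a) => {h1 h2}h1 h2; nra.
have := dotp_ge0 (y - N x); have {key} := key _ _ h1 h2; move=> h4 h3.
apply/esym/subr0_eq/dotp_eq0/eqP.
by rewrite eq_le h4 h3.
Qed.

Lemma near_point_near_lip x : D x -> exists C, \forall x' \near x, 
  D x' /\ enorm (N x' - N x) <= C * enorm (x' - x).
Proof.
move=> xD; have /nbhs_ballP[rho /= rho0 rD] := open_nbhs_nbhs (conj open_off_ridge xD).
have d0 := delta_gt0 Omega_open Omega_nT xD.1.
(* The balls are those of the sup norm, whereas delta is 1-Lipschitz for the Euclidean norm; this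
   explains the factor [n]. *)
pose d := delta Omega x + n%:R * rho; have rho2 : 0 < rho / 2 by rewrite divr_gt0.
have dd : delta Omega x <= d by rewrite lerDl mulr_ge0// ltW.
exists (1 + 2 * d / (rho / 2)); apply/nbhs_ballP; exists (rho / 2) => //= x' xx'.
split; first by apply: rD; apply: le_ball xx'; lra.
apply: near_point_lip_on => //; first exact: lt_le_trans d0 dd.
- by move=> z zx; apply: rD; apply: le_ball zx; lra.
- by move=> z zx'; apply: rD; rewrite [rho]splitr; exact: ball_triangle zx'.
- rewrite (le_trans (delta_lip Omega_nT x' x))// lerD2l (le_trans (enorm_le_norm _))//.
  rewrite ler_wpM2l//; move: xx'; rewrite -ball_normE /= distrC => /ltW /le_trans; apply;
    lra.
Qed.

Lemma continuous_near_point x : D x -> {for x, continuous N}.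
Proof.
move=> xD; have [C hC] := near_point_near_lip xD.
pose C' := `|C| * n%:R + 1; have C'0 : 0 < C' by rewrite ltr_wpDl// mulr_ge0.
move=> A /nbhs_ballP[e /= e0 eA]; move: hC => /nbhs_ballP[r /= r0 rC].
apply/nbhs_ballP; exists (Num.min r (e / C')) => /=; first by rewrite lt_min r0 divr_gt0.
move=> x'; rewrite -ball_normE /= lt_min distrC => /andP[xr xe].
have [_] : D x' /\ enorm (N x' - N x) <= C * enorm (x' - x).
  by apply: rC; rewrite -ball_normE /= distrC.
move=> h; apply: eA; rewrite -ball_normE /= distrC (le_lt_trans (norm_le_enorm _))//
  (le_lt_trans h)//.
move: xe; rewrite ltr_pdivlMr//; apply: le_lt_trans; rewrite (mulrC `|x' - x|).
apply: (@le_trans _ _ (`|C| * (n%:R * `|x' - x|))).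
  apply: (@le_trans _ _ (`|C| * enorm (x' - x))).
    by rewrite ler_wpM2r ?enorm_ge0 ?ler_norm.
  by rewrite ler_wpM2l ?enorm_le_norm.
by rewrite mulrA ler_wpM2r// lerDl.
Qed.

Lemma near_points_tangent x y v : near_points Omega x y ->
  tangent (boundary Omega) y v -> dotp (x - y) v = 0.
Proof.
move=> xy [g [g0 gb dg]].
have xy1 : near_points Omega (y + (1 : R) *: (x - y)) y by rewrite scale1r addrC subrK.
(* [h s] is |y - x|^2 - |g s - x|^2, which is at most 0 while the curve stays on the boundary. *)
pose h (s : R) := 2 * dotp (x - y) (g s - y) - dotp (g s - y) (g s - y).
have dgy : is_derive (0 : R) 1 (fun s => g s - y) v.
  have := is_deriveB dg (is_derive_cst y (0 : R) (1 : R)).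
  by rewrite subr0.
have dh : is_derive (0 : R) 1 h (2 * dotp (x - y) v).
  have h1 := is_derive_dotp (is_derive_cst (x - y) (0 : R) (1 : R)) dgy.
  have h2 := is_derive_dotp dgy dgy.
  have h3 := is_deriveB (is_deriveZ 2 h1) h2.
  apply: (@is_derive_eq _ _ _ h _ _ _ _ h3).
  by rewrite g0 subrr !dotp0l !dotp0r add0r addr0 subr0.
have := local_max_derive0 dh; rewrite /h g0 subrr !dotp0r mulr0 subr0 => /(_ erefl).
move=> H; apply/eqP; rewrite -(mulrI_eq0 _ (mulfI _) (x := 2))//; apply/eqP/H.
apply: filterS gb => s gs; rewrite subr_le0.
by have := near_point_ball Omega_nT xy1 (boundary_notin Omega_open gs); rewrite mulr1.
Qed.

End near_point_map.

(** * Graph charts of the boundary and the normal exponential map *)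

Section chart.
Variables (R : realType) (n : nat) (Omega : set 'rV[R]_n).
Variables (Q : 'M[R]_n) (j : 'I_n) (U : set 'rV[R]_n) (V : set 'rV[R]_n.-1).
Variable phi : 'rV[R]_n.-1 -> R.
Hypotheses (QQ : Q *m Q^T = 1%:M) (oU : open U) (oV : open V) (phiC2 : Ck_on V 2 phi).
Hypothesis chart : forall z, U z -> (boundary Omega z <->
  V (col' j (z *m Q)) /\ (z *m Q) ord0 j = phi (col' j (z *m Q))).
Implicit Types (x y z v w d : 'rV[R]_n).

Let QQ' : Q^T *m Q = 1%:M. Proof. exact: mulmx1C. Qed.

Lemma differentiable_mulmxr m p (B : 'M[R]_(m, p)) (u : 'rV[R]_m) : differentiable
  (mulmxr B) u.
Proof. exact/linear_differentiable/continuous_mulmxr. Qed.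

Lemma differentiable_col' (w : 'rV[R]_n) : differentiable
  (fun w => col' j w : 'rV[R]_n.-1) w.
Proof.
apply: differentiable_rV => k.
rewrite (_ : (fun _ => _) = (fun w : 'rV[R]_n => w ord0 (lift j k))).
  exact: differentiable_coord.
by apply/funext => z; rewrite mxE.
Qed.

Definition graph_vect (u : 'rV[R]_n.-1) (s : R) : 'rV[R]_n :=
  \row_i (if unlift j i is Some k then u ord0 k else s).

Lemma graph_vect_j u s : graph_vect u s ord0 j = s.
Proof. by rewrite mxE unlift_none. Qed.

Lemma graph_vect_lift u s k : graph_vect u s ord0 (lift j k) = u ord0 k.
Proof. by rewrite mxE liftK. Qed.

Lemma graph_vectK w : graph_vect (col' j w) (w ord0 j) = w.
Proof.
by apply/rowP => i; case: (unliftP j i) => [k|] ->;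
  rewrite ?graph_vect_j ?graph_vect_lift ?mxE.
Qed.

Lemma col'_graph_vect u s : col' j (graph_vect u s) = u.
Proof. by apply/rowP => k; rewrite mxE graph_vect_lift. Qed.

Lemma dotp_graph_vect w u s :
  dotp w (graph_vect u s) = w ord0 j * s + \sum_k w ord0 (lift j k) * u ord0 k.
Proof.
rewrite /dotp (bigD1_ord j)//= graph_vect_j; congr (_ + _).
by apply: eq_bigr => k _; rewrite graph_vect_lift.
Qed.

Lemma chart_tangent y k : boundary Omega y -> U y ->
  tangent (boundary Omega) y
    (graph_vect (delta_mx ord0 k) ('D_(delta_mx ord0 k) phi (col' j (y *m Q))) *m Q^T).
Proof.
move=> yb yU; have [Vy phiy] := (chart yU).1 yb; set u := col' j (y *m Q) in Vy phiy *.
pose G (s : R) := graph_vect (s *: delta_mx ord0 k + u) (phi (s *: delta_mx ord0 k + u)).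
have uE : (0 : R) *: delta_mx ord0 k + u = u by rewrite scale0r add0r.
have dphi : is_derive (0 : R) 1 (fun s : R => phi (s *: delta_mx ord0 k + u))
  ('D_(delta_mx ord0 k) phi u).
  have := @is_derive_line _ _ _ phi (delta_mx ord0 k) u 0; rewrite uE; apply.
  by have [_ /(_ k) [+ _]] := phiC2; apply.
have du : is_derive (0 : R) 1 (fun s : R => s *: delta_mx ord0 k + u) (delta_mx ord0 k).
  have := is_derive_scaler (is_derive_id (0 : R) 1)
    (is_derive_cst (delta_mx ord0 k : 'rV[R]_n.-1) (0 : R) (1 : R)).
  move=> h; have {}h := is_deriveD h (is_derive_cst u (0 : R) (1 : R)).
  apply: (@is_derive_eq _ _ _ (fun s : R => s *: delta_mx ord0 k + u) _ _ _ _ h).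
  by rewrite scale1r scaler0 !addr0.
have dG : is_derive (0 : R) 1 (fun s => G s *m Q^T)
    (graph_vect (delta_mx ord0 k) ('D_(delta_mx ord0 k) phi u) *m Q^T).
  apply: is_derive_mulmx; apply: is_derive_rV => i; case: (unliftP j i) => [l|] ->.
    rewrite graph_vect_lift (_ : (fun _ => _) =
      (fun s : R => (s *: delta_mx ord0 k + u) ord0 l)).
      exact: is_derive_coord.
    by apply/funext => s; rewrite /G graph_vect_lift.
  rewrite graph_vect_j (_ : (fun _ => _) = (fun s : R => phi (s *: delta_mx ord0 k + u)))//.
  by apply/funext => s; rewrite /G graph_vect_j.
have G0 : G 0 *m Q^T = y by rewrite /G uE -phiy graph_vectK -mulmxA QQ mulmx1.
exists (fun s => G s *m Q^T); split => //.
have cont (W : normedModType R) (h : R -> W) dh : is_derive (0 : R) 1 h dh -> {for 0,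
  continuous h}.
  by move=> [dh' _]; apply/differentiable_continuous/derivable1_diffP.
have nU : \forall s \near (0 : R), U (G s *m Q^T).
  by apply: (cont _ _ _ dG); rewrite G0; exact: open_nbhs_nbhs.
have nV : \forall s \near (0 : R), V (s *: delta_mx ord0 k + u).
  by apply: (cont _ _ _ du); rewrite uE; exact: open_nbhs_nbhs.
near=> s; have GU : U (G s *m Q^T) by near: s; exact: nU.
apply/(chart GU); rewrite -mulmxA QQ' mulmx1 /G col'_graph_vect graph_vect_j; split => //.
by near: s; exact: nV.
Unshelve. all: by end_near. Qed.

(* The normal space at [y] is spanned, in the coordinates [z *m Q], by
   [(- grad phi, 1)]. *)
Lemma chart_normal y d k : boundary Omega y -> U y ->
  (forall v, tangent (boundary Omega) y v -> dotp d v = 0) ->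
  (d *m Q) ord0 (lift j k) = - (d *m Q) ord0 j * 'D_(delta_mx ord0 k) phi (col' j (y *m Q)).
Proof.
move=> yb yU hd; have := hd _ (chart_tangent k yb yU).
rewrite -(dotp_mul _ _ QQ) -mulmxA QQ' mulmx1 dotp_graph_vect (bigD1 k)//= big1.
  rewrite (_ : delta_mx ord0 k ord0 k = 1); last by rewrite mxE !eqxx.
  by rewrite mulr1 addr0 addrC => /eqP; rewrite addr_eq0 mulNr => /eqP.
move=> i ik; rewrite (_ : delta_mx ord0 k ord0 i = 0) ?mulr0//.
by rewrite mxE (negbTE ik) andbF.
Qed.

(** By [chart_normal] a normal vector is determined by its coordinate [j], so normals are
    proportional. The cross-multiplied form avoids dividing by a coordinate. *)
Lemma chart_normal_inj y d d' : boundary Omega y -> U y ->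
  (forall v, tangent (boundary Omega) y v -> dotp d v = 0) ->
  (forall v, tangent (boundary Omega) y v -> dotp d' v = 0) ->
  (d' *m Q) ord0 j *: d = (d *m Q) ord0 j *: d'.
Proof.
move=> yb yU hd hd'; rewrite -[LHS](mulmx1 _) -[RHS](mulmx1 _) -QQ !mulmxA; congr (_ *m _).
rewrite -!scalemxAl; apply/rowP => i; rewrite mxE [RHS]mxE; case: (unliftP j i) => [k|] ->.
  by rewrite (chart_normal k yb yU hd) (chart_normal k yb yU hd'); ring.
by rewrite mulrC.
Qed.

Lemma chart_normal_neq0 y d : boundary Omega y -> U y ->
  (forall v, tangent (boundary Omega) y v -> dotp d v = 0) -> d != 0 ->
    (d *m Q) ord0 j != 0.
Proof.
move=> yb yU hd; apply: contra_neq => dj.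
rewrite -[d](mulmx1 _) -QQ mulmxA (_ : d *m Q = 0) ?mul0mx//.
apply/rowP => i; rewrite [RHS]mxE; case: (unliftP j i) => [k|] -> //.
by rewrite (chart_normal k yb yU hd) dj oppr0 mul0r.
Qed.

(* For [w] with coordinates [(u, s)], the point obtained from the boundary point
   above [u] by adding [s (- grad phi u, 1)]; the normal is deliberately not
   normalized. *)
Definition normal_exp w : 'rV[R]_n :=
  graph_vect (\row_k (w ord0 (lift j k) - w ord0 j * 'D_(delta_mx ord0 k) phi (col' j w)))
             (phi (col' j w) + w ord0 j) *m Q^T.

(** The second derivatives of [phi] enter here: the map involves the first ones, which must
    themselves be differentiable. *)
Lemma differentiable_normal_exp w : V (col' j w) -> differentiable normal_exp w.
Proof.
move=> Vw; have [cphi dphi] := phiC2.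
have dcomp (h : 'rV[R]_n.-1 -> R) : Ck_on V 1 h ->
  differentiable (fun w : 'rV[R]_n => h (col' j w)) w.
  move=> Ch; apply: (differentiable_comp (differentiable_col' w)).
  exact: differentiable_C1 oV Ch Vw.
have Cphi : Ck_on V 1 phi.
  by split => // i; have [? [? _]] := dphi i.
apply: (differentiable_comp (g := mulmxr Q^T)); last exact: differentiable_mulmxr.
apply: differentiable_rV => i; case: (unliftP j i) => [k|] ->.
  rewrite (_ : (fun _ => _) = (fun w : 'rV[R]_n => w ord0 (lift j k)) - 
     (fun w : 'rV[R]_n => w ord0 j : R) * (fun w => 'D_(delta_mx ord0 k) phi (col' j w)));
       last first.
    by apply/funext => z; rewrite graph_vect_lift mxE.
  apply: differentiableB; first exact: differentiable_coord.
  apply: differentiableM; first exact: differentiable_coord.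
  exact: (dcomp ('D_(delta_mx ord0 k) phi) (proj2 (dphi k))).
rewrite (_ : (fun _ => _) = (fun w => phi (col' j w)) +
  (fun w : 'rV[R]_n => w ord0 j : R)); last first.
  by apply/funext => z; rewrite graph_vect_j.
apply: differentiableD; first exact: dcomp.
exact: differentiable_coord.
Qed.

(* The coordinates [w] with [normal_exp w = x] when [y] is the near point of [x];
   they depend linearly on [(y, x)], and [y] on [(chart_coord y x, x)]. *)
Definition chart_coord y x : 'rV[R]_n :=
  graph_vect (col' j (y *m Q)) (((x - y) *m Q) ord0 j).

Lemma normal_expK y x : boundary Omega y -> U y ->
  (forall v, tangent (boundary Omega) y v -> dotp (x - y) v = 0) ->
  normal_exp (chart_coord y x) = x.
Proof.
move=> yb yU hd; have [_ phiy] := (chart yU).1 yb.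
rewrite -[RHS](mulmx1 _) -QQ mulmxA /normal_exp; congr (_ *m _).
rewrite /chart_coord col'_graph_vect graph_vect_j.
apply/rowP => i; case: (unliftP j i) => [k|] ->.
  rewrite graph_vect_lift mxE graph_vect_lift.
  have := chart_normal k yb yU hd; rewrite mulmxBl => h; rewrite -mulNr.
  have {}h : - (x *m Q - y *m Q) ord0 j * 'D_(delta_mx ord0 k) phi (col' j (y *m Q)) =
    (x *m Q - y *m Q) ord0 (lift j k) by [].
  by rewrite h !mxE; ring.
by rewrite graph_vect_j -phiy mulmxBl !mxE; ring.
Qed.

Let E : 'M[R]_n := delta_mx j j.

Lemma mulmx_deltaE (u : 'rV[R]_n) i : (u *m E) ord0 i = u ord0 j * (i == j)%:R.
Proof.
rewrite mxE (bigD1 j)//= big1 ?addr0 => [|k kj]; first by rewrite mxE eqxx.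
by rewrite mxE (negbTE kj) mulr0.
Qed.

(** Changes the sign of coordinate [j]. Being an involution, it allows the chart coordinates to be
    solved for [y]. *)
Definition reflect_j : 'M[R]_n := 1%:M - (E + E).

Lemma mulmx_reflectE (u : 'rV[R]_n) : u *m reflect_j = u - (u *m E + u *m E).
Proof. by rewrite mulmxBr mulmx1 mulmxDr. Qed.

Lemma chart_coordE y x :
  chart_coord y x = y *m (Q *m reflect_j) + x *m (Q *m E).
Proof.
rewrite !mulmxA mulmx_reflectE /chart_coord mulmxBl; apply/rowP => i.
move: (y *m Q) (x *m Q) => a b.
transitivity (a ord0 i - ((a *m E) ord0 i + (a *m E) ord0 i) + (b *m E) ord0 i);
  last by rewrite !mxE.
rewrite !mulmx_deltaE; case: (unliftP j i) => [k|] ->.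
  rewrite graph_vect_lift mxE eq_sym (negbTE (neq_lift j k)) !mulr0.
  by rewrite !addr0 subr0.
by rewrite graph_vect_j eqxx !mulr1 !mxE; ring.
Qed.

Lemma chart_coordK y x :
  y = (chart_coord y x - x *m (Q *m E)) *m (reflect_j *m Q^T).
Proof.
rewrite chart_coordE addrK !mulmxA; rewrite -(mulmxA (y *m Q)).
have -> : reflect_j *m reflect_j = 1%:M.
  have EE : E *m E = E by rewrite mul_delta_mx.
  rewrite /reflect_j mulmxBr mulmx1 mulmxBl mul1mx mulmxDl !mulmxDr EE.
  by apply/matrixP => i k; rewrite !mxE; ring.
by rewrite mulmx1 -mulmxA QQ mulmx1.
Qed.

Lemma mulmx_delta_lift (u : 'rV[R]_n) k : (u *m E) ord0 (lift j k) = 0.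
Proof. by rewrite mulmx_deltaE eq_sym (negbTE (neq_lift j k)) mulr0. Qed.

Lemma mulmx_reflect_lift (u : 'rV[R]_n) k :
  (u *m reflect_j) ord0 (lift j k) = u ord0 (lift j k).
Proof.
rewrite mulmx_reflectE; set z := u *m E.
transitivity (u ord0 (lift j k) - (z ord0 (lift j k) + z ord0 (lift j k))).
  by rewrite !mxE.
by rewrite mulmx_delta_lift addr0 subr0.
Qed.

Lemma col'_reflect (u x : 'rV[R]_n) : col' j ((u - x *m (Q *m E)) *m reflect_j) = col' j u.
Proof.
apply/rowP => k; rewrite mxE [in RHS]mxE mulmx_reflect_lift mulmxA; set z := _ *m E.
transitivity (u ord0 (lift j k) - z ord0 (lift j k)); first by rewrite !mxE.
by rewrite mulmx_delta_lift subr0.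
Qed.

End chart.

(** * Differentiability of the near point map and the range of its differential *)

Section near_point_differentiable.
Variables (R : realType) (n : nat) (Omega : set 'rV[R]_n).
Hypotheses (Omega_open : open Omega) (Omega_nT : ~` Omega !=set0).
Hypothesis ridge_closed : exists2 C : set 'rV[R]_n,
     closed C & ridge Omega = Omega `&` C.
Hypothesis Omega_C2 : C2_boundary Omega.
Implicit Types (x y z v w : 'rV[R]_n) (t : R).
Local Notation N := (near_point Omega).
Local Notation D := (Omega `\` ridge Omega).

Let nearP x : Omega x -> near_points Omega x (N x).
Proof. exact: near_pointP. Qed.

Lemma near_on_line x w (A : set 'rV[R]_n) : nbhs x A -> \forall s \near (0 : R),
  A (s *: w + x).
Proof.
move=> xA; have : {for (0 : R), continuous (fun s : R => s *: w + x)}.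
  by apply: differentiable_continuous; apply: differentiableD => //;
    exact: differentiableZl.
by apply; rewrite scale0r add0r.
Qed.

Lemma is_derive_near_point x w : differentiable N x ->
  is_derive (0 : R) 1 (fun s : R => N (s *: w + x)) ('d N x w).
Proof.
move=> dN; have := @is_derive_line _ _ _ N w x 0; rewrite scale0r add0r deriveE//.
by apply; exact: diff_derivable.
Qed.

Lemma near_point_diff_tangent x w : Omega x -> differentiable N x ->
  tangent (boundary Omega) (N x) ('d N x w).
Proof.
move=> xO dN; exists (fun s : R => N (s *: w + x)); split.
- by rewrite scale0r add0r.
- have nO : nbhs x Omega by exact: open_nbhs_nbhs.
  by apply: filterS (near_on_line w nO) => s sO; have [] := nearP sO.
- exact: is_derive_near_point.
Qed.

Lemma near_point_differentiable x : D x ->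
  differentiable N x /\
  forall v, tangent (boundary Omega) (N x) v -> exists w, 'd N x w = v.
Proof.
move=> xD; have xO := xD.1; have [yb dy] := nearP xO.
have [Q [j [U [V [phi [[QQ _] [oU yU] oV phiC2 chart]]]]]] := Omega_C2 yb.
have tg x' : Omega x' -> forall v,
  tangent (boundary Omega) (N x') v -> dotp (x' - N x') v = 0.
  by move=> x'O v; exact: (near_points_tangent Omega_open Omega_nT (nearP x'O)).
have [C hC] := near_point_near_lip Omega_open Omega_nT ridge_closed xD.
have nU : \forall x' \near x, U (N x').
  by apply: (continuous_near_point Omega_open Omega_nT ridge_closed xD);
    exact: open_nbhs_nbhs.
pose Uf x' := chart_coord Q j (N x') x'.
pose E : 'M[R]_n := delta_mx j j.
pose M1 := Q *m reflect_j R j; pose M2 := Q *m E.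
have UfE x' : Uf x' = N x' *m M1 + x' *m M2 by exact: chart_coordE.
have NE x' : N x' = (Uf x' - x' *m M2) *m (reflect_j R j *m Q^T) by exact: chart_coordK.
pose P := normal_exp Q j phi.
have dP : differentiable P (Uf x).
  apply: (differentiable_normal_exp _ oV phiC2); rewrite col'_graph_vect.
  by have [] := (chart _ yU).1 yb.
(* [Uf] is linear in (N x', x'), with matrices [M1] and [M2]; the first term carries the Lipschitz
   constant of [N], converted to sup norms. *)
pose C' := n%:R * `|M1| * (`|C| * n%:R) + n%:R * `|M2|.
have [|dUf UfK] := @differentiable_right_inverse R n P Uf x C' dP.
  move: hC nU => /nbhs_ballP[r /= r0 rh] /nbhs_ballP[q /= q0 qh].
  apply/nbhs_ballP; exists (Num.min r q) => /=; first by rewrite lt_min r0.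
  move=> x' xx'; have [|x'D h] := rh x'; first by apply: le_ball xx'; rewrite ge_min lexx.
  have U' : U (N x') by apply: qh; apply: le_ball xx'; rewrite ge_min lexx orbT.
  split.
    apply: (normal_expK QQ oU oV phiC2 chart _ U'); first by have [] := nearP x'D.1.
    exact: tg x'D.1.
  rewrite !UfE opprD addrACA -!mulmxBl (le_trans (ler_normD _ _))// /C' mulrDl lerD
    ?mulmx_norm_le//.
  rewrite (le_trans (mulmx_norm_le _ _))// -[leRHS]mulrA; apply: ler_wpM2l;
    first by rewrite mulr_ge0.
  rewrite (le_trans (norm_le_enorm _))// (le_trans h)//.
  apply: (@le_trans _ _ (`|C| * enorm (x' - x)));
    first by rewrite ler_wpM2r ?enorm_ge0 ?ler_norm.
  by rewrite -mulrA ler_wpM2l ?enorm_le_norm.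
have dNw w : is_derive x w N (('d Uf x w - w *m M2) *m (reflect_j R j *m Q^T)).
  rewrite (_ : N = fun x' => (Uf x' - x' *m M2) *m (reflect_j R j *m Q^T));
    last by apply/funext.
  apply: is_derive_mulmx; apply: is_deriveB.
    by rewrite -deriveE//; apply/derivableP; exact: diff_derivable.
  exact: is_derive_mulmx.
have dN : differentiable N x.
  rewrite (_ : N = fun x' => mulmxr (reflect_j R j *m Q^T) (Uf x' - mulmxr M2 x'));
    last by apply/funext.
  apply: (differentiable_comp (g := mulmxr (reflect_j R j *m Q^T)));
    last exact: differentiable_mulmxr.
  by apply: differentiableB => //; exact: differentiable_mulmxr.
split => // v vt.
(* The chart direction that follows [v] along the boundary and leaves the normal coordinate
   unchanged. As 'd Uf inverts 'd P, the direction [w] moves the chart coordinates by [k]. *)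
pose k := graph_vect j (col' j (v *m Q)) 0.
pose w := 'd P (Uf x) k; exists w.
have Lw : 'd N x w = (k - w *m M2) *m (reflect_j R j *m Q^T).
  by rewrite -deriveE//; have [_ ->] := dNw w; rewrite UfK.
have dLw := tg _ xO _ (near_point_diff_tangent w xO dN).
apply/esym/subr0_eq; set e := v - _.
(* Both vectors are tangent, and they agree in all rotated coordinates but [j]. The normal [x - N x]
   has a nonzero coordinate [j], so orthogonality to it removes the remaining one. *)
have de : dotp (x - N x) e = 0 by rewrite dotpDr dotpNr dLw (tg _ xO _ vt) subr0.
have eQ : col' j (e *m Q) = 0.
  have QQ' : Q^T *m Q = 1%:M := mulmx1C QQ.
  rewrite /e mulmxBl Lw -!mulmxA QQ' mulmx1 raddfB /= col'_reflect col'_graph_vect.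
  by rewrite subrr.
have d0 : x - N x != 0.
  rewrite subr_eq0; apply/eqP => xN; have := boundary_notin Omega_open yb; apply.
  by rewrite -xN.
have dj := chart_normal_neq0 QQ oU oV phiC2 chart yb yU (tg _ xO) d0.
move: de; rewrite -(dotp_mul _ _ QQ) -(graph_vectK j (e *m Q)) eQ dotp_graph_vect big1;
  last first.
  by move=> i _; rewrite (_ : (0 : 'rV[R]_n.-1) ord0 i = 0) ?mulr0// mxE.
rewrite addr0 => /eqP; rewrite mulf_eq0 (negbTE dj) /= => /eqP ej.
rewrite -[e]mulmx1 -QQ mulmxA -(graph_vectK j (e *m Q)) eQ ej.
rewrite (_ : graph_vect _ _ _ = 0) ?mul0mx//.
by apply/rowP => i; case: (unliftP j i) => [l|] ->;
  rewrite ?graph_vect_j ?graph_vect_lift !mxE.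
Qed.

End near_point_differentiable.

(** * The differential of the near point map and the principal curvatures *)

Lemma trace_orthonormal (R : realType) n (L : {linear 'rV[R]_n -> 'rV[R]_n})
  (b : 'I_n -> 'rV[R]_n) :
  (forall i j, dotp (b i) (b j) = (i == j)%:R) ->
  \sum_i (L (delta_mx ord0 i)) ord0 i = \sum_i dotp (L (b i)) (b i).
Proof.
move=> hb; set A := lin1_mx L; pose B := \matrix_i b i.
have rB i : row i B = b i by rewrite rowK.
have BB : B *m B^T = 1%:M.
  apply/matrixP => i j; rewrite !mxE -hb; apply: eq_bigr => k _.
  by rewrite -(rB i) -(rB j) !mxE.
transitivity (\tr A).
  apply: eq_bigr => i _; have -> : L (delta_mx ord0 i) = row i A.
    by rewrite rowE mul_rV_lin1.
  by rewrite mxE.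
transitivity (\tr (B *m A *m B^T)).
  by rewrite mxtrace_mulC mulmxA (mulmx1C BB) mul1mx.
apply: eq_bigr => i _; rewrite mxE; apply: eq_bigr => k _.
have -> : L (b i) = row i (B *m A) by rewrite row_mul rB mul_rV_lin1.
by rewrite -(rB i) !mxE.
Qed.

Section delta_derivative.
Variables (R : realType) (n : nat) (Omega : set 'rV[R]_n).
Hypotheses (Omega_open : open Omega) (Omega_nT : ~` Omega !=set0).
Hypothesis ridge_closed : exists2 C : set 'rV[R]_n,
     closed C & ridge Omega = Omega `&` C.
Hypothesis Omega_C2 : C2_boundary Omega.
Implicit Types (x y z v w : 'rV[R]_n) (t : R).
Local Notation N := (near_point Omega).
Local Notation D := (Omega `\` ridge Omega).
Local Notation delta := (delta Omega).

Let nearP x : Omega x -> near_points Omega x (N x).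
Proof. exact: near_pointP. Qed.

Let nD x : D x -> nbhs x D.
Proof. by move=> xD; apply: open_nbhs_nbhs; split => //; exact: open_off_ridge. Qed.

Let dN x : D x -> differentiable N x.
Proof. by move=> xD; have [] :=
  near_point_differentiable Omega_open Omega_nT ridge_closed Omega_C2 xD. Qed.

Lemma delta_near_point x : Omega x -> delta x = enorm (x - N x).
Proof. by move=> /nearP[_ <-]; rewrite enorm_distC. Qed.

Lemma delta_sqr x : Omega x -> delta x ^+ 2 = dotp (x - N x) (x - N x).
Proof. by move=> xO; rewrite delta_near_point// enorm_sqr. Qed.

Lemma near_point_orth x v : Omega x -> tangent (boundary Omega) (N x) v ->
  dotp (x - N x) v = 0.
Proof. by move=> xO; exact: (near_points_tangent Omega_open Omega_nT (nearP xO)). Qed.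

Lemma differentiable_delta x : D x -> differentiable delta x.
Proof.
move=> xD; apply: (@near_eq_differentiable _ _ _ _
  (fun x => Num.sqrt (dotp (x - N x) (x - N x)))).
  by apply: filterS (nD xD) => z [zO _]; rewrite delta_near_point.
have dxN : differentiable (fun x => x - N x) x by apply: differentiableB => //; exact: dN.
apply: (@differentiable_comp _ _ _ _ (fun x => dotp (x - N x) (x - N x)) Num.sqrt).
  exact: differentiable_dotp.
apply/derivable1_diffP; have := is_derive1_sqrt (x := dotp (x - N x) (x - N x)).
case; last by [].
by rewrite -delta_sqr ?exprn_gt0 ?(delta_gt0 Omega_open Omega_nT) ?xD.1//; exact: xD.1.
Qed.

(** Differentiate delta^2 = |x - N x|^2: the contribution of 'd N is tangent to the boundary, hence
    orthogonal to [x - N x]. *)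
Lemma is_derive_delta x w : D x -> is_derive x w delta (dotp (x - N x) w / delta x).
Proof.
move=> xD; have xO := xD.1; have d0 := delta_gt0 Omega_open Omega_nT xO.
have dd : derivable delta x w by apply: diff_derivable; exact: differentiable_delta.
apply: DeriveDef => //.
have h1 := is_deriveM (derivableP dd) (derivableP dd).
have hN : is_derive x w (fun x => x - N x) (w - 'd N x w).
  apply: is_deriveB; rewrite -deriveE; last exact: dN.
  by apply/derivableP/diff_derivable/dN.
have h2 := is_derive_dotp hN hN.
have h3 : is_derive x w (delta * delta)
  (dotp (w - 'd N x w) (x - N x) + dotp (x - N x) (w - 'd N x w)).
  apply: near_eq_is_derive h2; apply: filterS (nD xD) => z [zO _] /=.
  by rewrite -delta_sqr// expr2.
have [_] := h3; have [_ ->] := h1; rewrite (dotpC (w - _)) dotpDr dotpNr.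
rewrite (near_point_orth xO (near_point_diff_tangent Omega_open Omega_nT w xO (dN xD)))
  subr0.
set c := 'D_w delta x; set e := dotp _ w => h.
have {}h : delta x * c + delta x * c = e + e := h.
have -> : e = delta x * c by lra.
by rewrite mulrAC divff ?mul1r// gt_eqF.
Qed.

(** [N] is constant on the line through [x] and [N x] near [x]: on the side of [N x] by
    [near_point_segment], and beyond [x] because the touching ball can be enlarged. *)
Lemma diff_near_point_normal x : D x -> 'd N x (x - N x) = 0.
Proof.
move=> xD; have xO := xD.1; have d0 := delta_gt0 Omega_open Omega_nT xO.
have [_ <-] := is_derive_near_point (x - N x) (dN xD).
have /nbhs_ballP[rho /= rho0 rD] := nD xD.
have hN := near_point_extends_at Omega_open Omega_nT rho0 rD (lexx _).
set e := rho / (2 * delta x) in hN; have e0 : 0 < e by rewrite divr_gt0// mulr_gt0.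
rewrite (@near_eq_derive _ _ _ _ (cst (N x))) ?derive_cst//.
have nb : \forall s \near (0 : R), D (s *: (x - N x) + x) := near_on_line (x - N x) (nD xD).
have nm : \forall s \near (0 : R), `|s| < Num.min 1 e.
  apply/nbhs_ballP; exists (Num.min 1 e) => /=; first by rewrite lt_min ltr01.
  by move=> s; rewrite -ball_normE /= sub0r normrN.
near=> s; have sD : D (s *: (x - N x) + x) by near: s; exact: nb.
apply: (near_point_unique Omega_open Omega_nT ridge_closed sD).
have -> : s *: (x - N x) + x = N x + (1 + s) *: (x - N x).
  by rewrite scalerDl scale1r addrA [N x + _]addrC subrK addrC.
have sm : `|s| < Num.min 1 e by near: s; exact: nm.
apply: (near_point_segment Omega_open Omega_nT hN).
move: sm; rewrite lt_min !ltr_norml => /andP[/andP[s1 _] /andP[_ s2]].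
by apply/andP; split; lra.
Unshelve. all: by end_near. Qed.

Lemma normal_segment_in x t : Omega x -> 0 < t -> t <= 1 -> Omega (N x + t *: (x - N x)).
Proof.
move=> xO t0 t1; have d0 := delta_gt0 Omega_open Omega_nT xO; apply: contrapT => tO.
have := delta_le Omega_nT x tO; rewrite (_ : _ - x = (1 - t) *: (N x - x)); last first.
  by apply/rowP => i; rewrite !mxE; ring.
have [_ Nd] := nearP xO.
by rewrite enormZ Nd ger0_norm ?subr_ge0// => h; nra.
Qed.

(** Normals at a boundary point are proportional, so the unit length leaves two candidates, and the
    inward condition selects one. *)
Lemma inner_normal_near x nu : Omega x -> inner_unit_normal Omega nu ->
  nu (N x) = (delta x)^-1 *: (x - N x).
Proof.
move=> xO hnu; have [yb Nd] := nearP xO; have d0 := delta_gt0 Omega_open Omega_nT xO.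
have [nu1 nut nuin] := hnu _ yb.
have [Q [j [U [V [phi [[QQ _] [oU yU] oV phiC2 chart]]]]]] := Omega_C2 yb.
have tg := fun v => @near_point_orth x v xO.
have xN0 : x - N x != 0.
  by apply: contraTneq d0 => xN; rewrite delta_near_point// xN /enorm dotp0l sqrtr0 ltxx.
have dj := chart_normal_neq0 QQ oU oV phiC2 chart yb yU tg xN0.
have := chart_normal_inj QQ oU oV phiC2 chart yb yU tg nut.
set a := (x - N x) in xN0 dj tg *; set c1 := (nu (N x) *m Q) ord0 j => h.
pose c := c1 / (a *m Q) ord0 j.
have nuE : nu (N x) = c *: a.
  by rewrite /c mulrC -scalerA h scalerA mulVf// scale1r.
have cd : `|c| * delta x = 1 by rewrite -nu1 nuE enormZ delta_near_point.
have dne : delta x != 0 by rewrite gt_eqF.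
have [c0|c0] := leP 0 c.
  by rewrite nuE; congr (_ *: _); apply: (mulIf dne); rewrite mulVf ?gt_eqF// -cd ger0_norm.
(* With the opposite sign, N x - t nu would move from [N x] towards [x] and stay in [Omega]. The
   bound t <= delta x keeps it on that segment. *)
exfalso; move: nuin => /nbhs_ballP[r /= r0 rh].
have nuN : nu (N x) = - ((delta x)^-1 *: a).
  rewrite nuE -scaleNr; congr (_ *: _); apply: (mulIf dne).
  by rewrite mulNr mulVf ?gt_eqF// -cd ltr0_norm// mulNr opprK.
pose t := Num.min (r / 2) (delta x).
have t0 : 0 < t by rewrite lt_min d0 andbT divr_gt0.
have [|//|_] := rh t; first rewrite -ball_normE /= sub0r normrN gtr0_norm//.
  by rewrite (@le_lt_trans _ _ (r / 2)) ?ge_min ?lexx//; lra.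
apply; rewrite nuN scalerN opprK scalerA; apply: normal_segment_in => //.
  by rewrite divr_gt0.
by rewrite ler_pdivrMr// mul1r ge_min lexx orbT.
Qed.

Lemma near_point_trace x kappa : D x -> principal_curvatures Omega (N x) kappa ->
  \sum_i ('d N x (delta_mx ord0 i)) ord0 i = n.-1%:R - delta x * kappa_tilde Omega kappa x.
Proof.
move=> xD [nu [v [hnu vv hv]]]; have xO := xD.1; have [yb Nd] := nearP xO.
have d0 := delta_gt0 Omega_open Omega_nT xO.
(* The chart supplies an index [j], the place of [nu (N x)] in the orthonormal basis [b]; the [v k]
   fill the others. *)
have [Q [j _]] := Omega_C2 yb.
have nuN z : Omega z -> nu (N z) = (delta z)^-1 *: (z - N z) by move=> zO;
  exact: inner_normal_near.
have [nu1 nut _] := hnu _ yb.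
have vne k : v k != 0.
  by apply/eqP => v0; have := vv k k; rewrite v0 dotp0l eqxx => /eqP;
    rewrite eq_sym oner_eq0.
(* Take [w] with 'd N x w = v k and differentiate z - N z = delta z * nu (N z) along [w]. This gives
   w = (1 + delta kappa) v plus a normal vector, which 'd N x annihilates. *)
have Lv k : (1 + delta x * kappa k) *: 'd N x (v k) = v k.
  have [vt dnu] := hv k.
  have [_ /(_ _ vt)[w Lw]] := near_point_differentiable Omega_open Omega_nT ridge_closed
    Omega_C2 xD.
  have dNw := is_derive_near_point w (dN xD).
  have curve : curve_on (boundary Omega) (N x) (v k) (fun s : R => N (s *: w + x)).
    split; first by rewrite scale0r add0r.
      by apply: filterS (near_on_line w (nD xD)) => s [sO _]; have [] := nearP sO.
    by rewrite -Lw.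
  have dnuN := dnu _ curve.
  have dd : is_derive (0 : R) 1 (fun s : R => delta (s *: w + x)) ('D_w delta x).
    have := @is_derive_line _ _ _ delta w x 0; rewrite scale0r add0r; apply.
    by apply: diff_derivable; exact: differentiable_delta.
  have hR := is_derive_scaler dd dnuN.
  have hx : is_derive (0 : R) 1 (fun s : R => s *: w + x) w.
    have h := is_derive_scaler (is_derive_id (0 : R) 1) (is_derive_cst w (0 : R) (1 : R)).
    have {}h := is_deriveD h (is_derive_cst x (0 : R) (1 : R)).
    apply: (@is_derive_eq _ _ _ (fun s : R => s *: w + x) _ _ _ _ h).
    by rewrite scale1r scaler0 !addr0.
  have hL := is_deriveB hx dNw.
  have hL' : is_derive (0 : R) 1 ((fun s : R => s *: w + x) - (fun s : R => N (s *: w + x)))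
     ('D_w delta x *: nu (N x) + delta x *: (kappa k *: v k)).
    move: hR; rewrite /= scale0r add0r; apply: near_eq_is_derive.
    apply: filterS (near_on_line w (nD xD)) => s [sO _].
    have ds := delta_gt0 Omega_open Omega_nT sO.
    by rewrite /= nuN// scalerA divff ?gt_eqF// scale1r.
  have [_ E1] := hL; have [_] := hL'; rewrite E1 Lw => E2.
  have Ew : w = (1 + delta x * kappa k) *: v k + ('D_w delta x / delta x) *: (x - N x).
    rewrite -[w in LHS](subrK (v k)) E2 nuN// scalerDl scale1r !scalerA.
    by rewrite addrC -addrA [X in _ + X]addrC.
  have := congr1 ('d N x) Ew; rewrite linearD !linearZ /= diff_near_point_normal// scaler0
    addr0.
  by rewrite Lw => <-.
(* Since [v k] is nonzero, [Lv] itself excludes a vanishing denominator in [kappa_tilde]. *)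
have kne k : 1 + delta x * kappa k != 0.
  by apply/eqP => k0; have := Lv k; rewrite k0 scale0r => /esym/eqP;
    rewrite (negbTE (vne k)).
pose b i := if unlift j i is Some k then v k else nu (N x).
have bl k : b (lift j k) = v k by rewrite /b liftK.
have bj : b j = nu (N x) by rewrite /b unlift_none.
have nuv k : dotp (nu (N x)) (v k) = 0 by apply: nut; have [] := hv k.
rewrite (trace_orthonormal _ (b := b)); last first.
  move=> i i'; case: (unliftP j i) => [k|] ->; case: (unliftP j i') => [k'|] ->;
    rewrite ?bl ?bj.
  - by rewrite vv (inj_eq (lift_inj (h := j))).
  - by rewrite dotpC nuv eq_sym (negbTE (neq_lift j k)).
  - by rewrite nuv (negbTE (neq_lift j k')).
  - by rewrite -enorm_sqr nu1 expr1n eqxx.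
rewrite (bigD1_ord j)//= bj nuN// linearZ /= diff_near_point_normal// scaler0 dotp0l add0r.
have -> : n.-1%:R = \sum_(k < n.-1) (1 : R) by rewrite sumr_const card_ord.
(* Termwise this is 1 / (1 + delta kappa) = 1 - delta kappa / (1 + delta kappa). *)
rewrite /kappa_tilde mulr_sumr -sumrB.
apply: eq_bigr => k _; rewrite bl.
have -> : 'd N x (v k) = (1 + delta x * kappa k)^-1 *: v k.
  by rewrite -[in RHS](Lv k) scalerA mulVf// scale1r.
rewrite dotpZl vv eqxx mulr1; apply: (mulIf (kne k)); rewrite mulVf// mulrBl mul1r -mulrA.
by rewrite divfK// addrK.
Qed.

End delta_derivative.

(** * Integration by parts without continuity of the derivative *)

Lemma lebesgue_measure_shift (R : realType) (a : R) (A : set (measurableTypeR R)) :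
  measurable A ->
  lebesgue_measure ((fun t : measurableTypeR R => t + a : measurableTypeR R) @^-1` A)
   = lebesgue_measure A.
Proof.
move=> mA; have mf : measurable_fun setT
  (fun t : measurableTypeR R => t + a : measurableTypeR R).
  exact: measurable_funD.
pose f : measurableTypeR R -> measurableTypeR R := fun t => t + a.
apply/esym.
apply: (@lebesgue_measure_unique R (pushforward lebesgue_measure f)) => // _ [[x y]] _ <-.
transitivity (lebesgue_measure `]x - a, y - a]%classic); last first.
  rewrite /pushforward; congr (lebesgue_measure _).
  by apply/seteqP; split => t /=; rewrite /f !in_itv/= ltrBlDr lerBrDr.
rewrite !lebesgue_measure_itv/= !lte_fin ltrD2r; case: ifPn => // _.
by rewrite -!EFinB; congr EFin; ring.
Qed.

Section translation.
Variables (R : realType).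

Lemma measurable_rV_shift n (v : 'rV[R]_n) :
  measurable_fun setT (fun x : 'rV[R]_n => x + v).
Proof.
apply: measurable_fun_rV => i.
rewrite (_ : _ \o _ = (fun x => rV_coord i x + v ord0 i)); last first.
  by apply/funext => x; rewrite /rV_coord /= mxE.
by apply: measurable_funD => //; exact: measurable_rV_coord.
Qed.

(** [rV_cons] turns the translation into a product of translations, and a measure with the right
    values on rectangles is the product measure. *)
Lemma lebesgue_rV_shift n (v : 'rV[R]_n) (A : set 'rV[R]_n) : measurable A ->
  lebesgue_rV R n ((fun x => x + v) @^-1` A) = lebesgue_rV R n A.
Proof.
elim: n v A => [v A mA|n IH v A mA].
  by congr (lebesgue_rV R 0 _); apply/seteqP; split => x /=;
    rewrite [x + v]thinmx0 [x]thinmx0.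
pose mu := lebesgue_rV R n.
pose T (p : measurableTypeR R * 'rV[R]_n) : measurableTypeR R * 'rV[R]_n :=
  ((p.1 + (rV_uncons v).1 : measurableTypeR R), p.2 + (rV_uncons v).2).
have mT : measurable_fun setT T.
  apply/measurable_fun_pairP; split.
    by apply: measurable_funD => //; exact: measurable_fst.
  apply: (measurableT_comp (measurable_rV_shift (rV_uncons v).2)).
  exact: measurable_snd.
have mB : measurable (@rV_cons R n @^-1` A).
  by rewrite -[X in measurable X]setTI; exact: measurable_rV_cons.
rewrite /= /lebesgue_step /pushforward.
have -> : @rV_cons R n @^-1` ((fun x => x + v) @^-1` A) = T @^-1` (@rV_cons R n @^-1` A).
  apply/seteqP; suff h p : rV_cons p + v = rV_cons (T p).
    by split => p /=; rewrite h.
  apply/rowP => i; rewrite mxE -/(rV_coord _ _).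
  case: (unliftP ord0 i) => [j|] ->.
    by rewrite [RHS](rV_consS (T p)) (rV_consS p) /= !mxE.
  by rewrite [RHS](rV_cons0 (T p)) rV_cons0 /= /rV_coord.
apply/esym; rewrite -[RHS]/(pushforward (lebesgue_measure \x mu)%E T
  (@rV_cons R n @^-1` A)).
apply: (@product_measure_unique _ _ _ _ R lebesgue_measure mu
  (pushforward (lebesgue_measure \x mu)%E T)) => //.
move=> C D mC mD; rewrite /pushforward.
transitivity ((lebesgue_measure \x mu)%E
   (((fun t : measurableTypeR R => t + (rV_uncons v).1 : measurableTypeR R) @^-1` C) `*`
   ((fun x => x + (rV_uncons v).2) @^-1` D))).
  by congr ((_ \x _)%E _); apply/seteqP; split => p.
rewrite product_measure1E//.
- by congr (_ * _)%E; [exact: lebesgue_measure_shift | exact: IH].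
- rewrite -[X in measurable X]setTI.
  have : measurable_fun setT (fun t : measurableTypeR R => t + (rV_uncons v).1 :
    measurableTypeR R).
    exact: measurable_funD.
  exact.
- by rewrite -[X in measurable X]setTI; exact: measurable_rV_shift.
Qed.

End translation.

(** * Measurability and integrals of compactly supported functions *)

Section rV_integral.
Variables (R : realType) (n : nat).
Implicit Types (x v : 'rV[R]_n) (F : 'rV[R]_n -> R) (M : R).

Lemma rV_norm_le x M : 0 <= M -> (`|x| <= M) <-> (forall i, `|x ord0 i| <= M).
Proof.
move=> M0; rewrite {1}/Num.Def.normr/= mx_normrE; split => [h i|h].
  by apply: le_trans h; apply: (le_trans _ (le_bigmax _ _ (ord0, i))).
by apply: bigmax_le => // -[i j] _ /=; rewrite ord1.
Qed.

Lemma measurable_rV_box (a b : 'I_n -> R) :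
  measurable [set x : 'rV[R]_n | forall i, a i <= x ord0 i <= b i].
Proof.
rewrite (_ : mkset _ = \bigcap_(i in [set: 'I_n])
  (@rV_coord R n i @^-1` `[a i, b i]%classic)).
  apply: fin_bigcap_measurable => // i _.
  by rewrite -[X in measurable X]setTI; apply: measurable_rV_coord.
apply/seteqP; split => x /= h i; first by move=> _; rewrite /= in_itv; exact: h.
by have := h i I; rewrite /= in_itv.
Qed.

(** The sigma-algebra is generated by coordinates, so an open set is exhibited as a countable union
    of boxes with rational centres and half-widths 1 / (k + 1). *)
Lemma measurable_rV_open (U : set 'rV[R]_n) : open U -> measurable U.
Proof.
move=> oU.
pose B (p : 'rV[rat]_n * nat) : set 'rV[R]_n :=
  [set x | forall i, ratr (p.1 ord0 i) - p.2.+1%:R^-1 <= x ord0 i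
                     <= ratr (p.1 ord0 i) + p.2.+1%:R^-1].
pose E (p : 'rV[rat]_n * nat) : set 'rV[R]_n := if `[< B p `<=` U >] then B p else set0.
rewrite (_ : U = \bigcup_p E p).
  apply: countable_bigcupT_measurable => // p; rewrite /E; case: ifPn => // _.
  exact: measurable_rV_box.
apply/seteqP; split => [x Ux|x [p _]]; last first.
  by rewrite /E; case: ifPn => // /asboolP + Bx; exact.
have /nbhs_ballP [e /= e0 eU] := open_nbhs_nbhs (conj oU Ux).
have [k _ ke] := near_infty_natSinv_lt (PosNum (divr_gt0 e0 (ltr0n _ 2))).
have {}ke : k.+1%:R^-1 < e / 2 := ke k (leqnn _).
have k0 : 0 < k.+1%:R^-1 :> R by rewrite invr_gt0.
set r : R := k.+1%:R^-1 in ke k0.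
have /choice[q hq] : forall i, exists q : rat, ratr q \in `]x ord0 i - r, x ord0 i + r[.
  by move=> i; apply: rat_in_itvoo; lra.
have xB : B (\row_i q i, k) x.
  by move=> i /=; rewrite mxE -/r; have := hq i; rewrite in_itv /=; move=> /andP[? ?];
    apply/andP; split; lra.
exists (\row_i q i, k) => //; rewrite /E; case: ifPn => [//|/asboolP BU]; exfalso;
  apply: BU => y yB; apply: eU; rewrite -ball_normE /=;
  suff : `|x - y| <= r * 2 by move/le_lt_trans; apply; lra.
apply/rV_norm_le; first by rewrite mulr_ge0// ltW.
move=> i; rewrite !mxE ler_norml; have := xB i; have := yB i; rewrite /= mxE -/r.
by move=> /andP[? ?] /andP[? ?]; apply/andP; split; lra.
Qed.

Lemma continuous_measurable_rV F : continuous F -> measurable_fun setT F.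
Proof.
move=> /continuousP cF; apply: (measurability _ (RGenOpens.measurableE R)).
move=> _ [_ [a [b ->] <-]]; rewrite setTI; apply: measurable_rV_open.
exact/cF/interval_open.
Qed.

Lemma lebesgue_rV_norm_lty M : (lebesgue_rV R n [set x | (`|x| <= M)%R] < +oo)%E.
Proof.
have [M0|M0] := leP 0 M; last first.
  rewrite (_ : [set x | (`|x| <= M)%R] = set0) ?measure0//; apply/seteqP;
    split => // x /= h.
  by have := le_lt_trans (le_trans (normr_ge0 x) h) M0; rewrite ltxx.
rewrite (_ : [set x | (`|x| <= M)%R] = [set x : 'rV[R]_n | forall i,
  (- M <= x ord0 i <= M)%R]).
  by rewrite (lebesgue_rV_box (a := fun=> - M) (b := fun=> M)) ?ltry// => _; rewrite ge0_cp.
by apply/seteqP; split => x /=; rewrite (rV_norm_le _ M0) => h i; have := h i;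
  rewrite ler_norml.
Qed.

Lemma measurable_rV_norm M : measurable [set x : 'rV[R]_n | `|x| <= M].
Proof.
rewrite -[X in measurable X]setCK; apply: measurableC; apply: measurable_rV_open.
apply: closed_openC; rewrite (_ : mkset _ = Num.Def.normr @^-1` [set t : R | t <= M])//.
by apply: preimage_closed; [move=> x _; exact: norm_continuous|exact: closed_le].
Qed.

Lemma integrable_continuous_csupp F M : continuous F ->
  (forall x, F x != 0 -> `|x| <= M) ->
  (lebesgue_rV R n).-integrable setT (EFin \o F).
Proof.
move=> cF suppF; pose B := [set x : 'rV[R]_n | `|x| <= M].
have mB := measurable_rV_norm M.
suff h : (lebesgue_rV R n).-integrable B (EFin \o F).
  move/(integrable_mkcond _ mB): h; apply: eq_integrable => // x _ /=.
  rewrite /patch; case: ifPn => //; rewrite notin_setE => xB; apply/esym/eqP.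
  by rewrite eqe; apply: contraPT xB => /suppF ?; apply.
apply: measurable_bounded_integrable => //.
- exact: lebesgue_rV_norm_lty.
- by apply: measurable_funTS; exact: continuous_measurable_rV.
have cB : compact B.
  apply: bounded_closed_compact.
    by exists M; split; [exact: num_real|move=> y yM x xM; exact: le_trans xM (ltW yM)].
  rewrite (_ : B = Num.Def.normr @^-1` [set t : R | t <= M])//.
  by apply: preimage_closed; [move=> x _; exact: norm_continuous|exact: closed_le].
have /compact_bounded[N [_ Nb]] : compact (F @` B).
  by apply: continuous_compact => //; exact: continuous_subspaceT.
exists N; split; first exact: num_real.
by move=> y Ny x xB; apply: Nb => //; exists x.
Qed.

Lemma lebesgue_rV_integral_shift F v : measurable_fun setT F ->
  (lebesgue_rV R n).-integrable setT (EFin \o F) ->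
  (lebesgue_rV R n).-integrable setT (EFin \o (fun x => F (x + v))) /\
  (\int[lebesgue_rV R n]_x (F (x + v))%:E = \int[lebesgue_rV R n]_x (F x)%:E)%E.
Proof.
move=> mF intF; have ms := measurable_rV_shift v.
have mFs : measurable_fun setT (fun x => F (x + v)) by exact: measurableT_comp mF ms.
have pE (f : 'rV[R]_n -> \bar R) :
  (\int[lebesgue_rV R n]_x f x =
    \int[pushforward (lebesgue_rV R n) (fun x => (x + v)%R)]_x f x)%E.
  by apply: eq_measure_integral => //= A mA _; rewrite /pushforward lebesgue_rV_shift.
have intFs : (lebesgue_rV R n).-integrable setT (EFin \o (fun x => F (x + v))).
  apply/integrableP; split; first exact/measurable_EFinP.
  move/integrableP : intF => [_]; rewrite pE ge0_integral_pushforward//.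
  by apply: measurableT_comp => //; exact/measurable_EFinP.
split => //; rewrite [RHS]pE.
rewrite (@integral_pushforward _ _ _ _ _ _ ms _ _ (EFin \o F)) ?preimage_setT//.
exact/measurable_EFinP.
Qed.

(* The difference quotients have integral 0 by translation invariance and are
   dominated by the Lipschitz constant; the derivative need not be continuous. *)
Lemma integral_derive_csupp F v C M : continuous F ->
  (forall x, F x != 0 -> `|x| <= M) ->
  (forall x (h : R), `|F (x + h *: v) - F x| <= C * `|h|) ->
  (forall x, derivable F x v) ->
  (lebesgue_rV R n).-integrable setT (EFin \o 'D_v F) /\
  (\int[lebesgue_rV R n]_x ('D_v F x)%:E = 0)%E.
Proof.
move=> cF suppF lipF dF; pose mu := lebesgue_rV R n.
have mF := continuous_measurable_rV cF.
have intF := integrable_continuous_csupp cF suppF.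
have C0 : 0 <= C.
  have := lipF 0 1; rewrite normr1 mulr1; apply: le_trans; exact: normr_ge0.
pose h k : R := k.+1%:R^-1.
have h0 k : 0 < h k by rewrite invr_gt0.
have h1 k : h k <= 1 by rewrite invf_le1// ler1n.
pose g k x : R := (h k)^-1 * (F (x + h k *: v) - F x).
(* Since [h k <= 1], every difference quotient vanishes outside [B]. *)
pose B := [set x : 'rV[R]_n | `|x| <= M + `|v|].
have mB : measurable B := measurable_rV_norm _.
have mg k : measurable_fun setT (g k).
  apply: measurable_funM => //; apply: measurable_funB => //.
  exact: measurableT_comp mF (measurable_rV_shift _).
have gD x : g^~ x @ \oo --> 'D_v F x.
  have := dF x => /derivable1P; rewrite /derivable /= => dFx.
  have cD : h^-1 *: (F (h *: v + x) - F x) @[h --> 0^'] --> 'D_v F x by exact: dF.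
  have ch : h @ \oo --> 0^'.
    move=> A /= [e /= e0 eA]; have := @cvg_harmonic R.
    move=> /cvgrPdist_lt /(_ _ e0) [N _ hN]; exists N => // k Nk.
    apply: eA; first exact: hN.
    by rewrite gt_eqF.
  have := cvg_comp _ _ ch cD; apply: cvg_trans; apply: near_eq_cvg.
  by apply: nearW => k /=; rewrite /g (addrC x).
have gB k x : `|g k x| <= C * \1_B x.
  rewrite /g normrM gtr0_norm ?invr_gt0//.
  have [xB|xB] := boolP (x \in B).
    rewrite indicE xB mulr1 ler_pdivrMl// mulrC.
    by have := lipF x (h k); rewrite (gtr0_norm (h0 k)).
  rewrite indicE (negbTE xB) mulr0; move: xB; rewrite notin_setE /B /= => /negP;
    rewrite -ltNge => xB.
  have -> : F x = 0.
    apply/eqP/negPn/negP => /suppF; apply/negP; rewrite -ltNge (le_lt_trans _ xB)//.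
    by rewrite lerDl.
  have -> : F (x + h k *: v) = 0.
    apply/eqP/negPn/negP => /suppF H; move: xB; apply/negP; rewrite -leNgt.
    rewrite -[x](addrK (h k *: v)) (le_trans (ler_normB _ _))// lerD// normrZ gtr0_norm//.
    by rewrite ler_piMl.
  by rewrite subr0 normr0 mulr0.
have mD : measurable_fun setT ('D_v F).
  by apply: (measurable_fun_cvg (h := g)) => // x _; exact: gD.
have intdom : mu.-integrable setT (fun x => (C * \1_B x)%:E).
  under eq_fun do rewrite EFinM.
  apply: integrableZl => //.
  apply: (eq_integrable _ (EFin \o \1_B)) => //.
  apply/integrableP; split; first exact/measurable_EFinP/measurable_indic.
  rewrite (eq_integral (fun x => (\1_B x)%:E)); last first.
    by move=> x _ /=; rewrite ger0_norm.
  by rewrite integral_indic// setIT; exact: lebesgue_rV_norm_lty.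
have ig k : (\int[mu]_x (g k x)%:E = 0)%E.
  have [isF se] := lebesgue_rV_integral_shift (h k *: v) mF intF.
  under eq_integral do rewrite EFinM EFinB.
  rewrite integralZl//; last exact: integrableB.
  rewrite integralB_EFin// se subee ?mule0//.
  exact: integrable_fin_num.
have [|||||iD _ cvD] := @dominated_convergence _ _ R mu setT measurableT
  (fun k => EFin \o g k)
  (EFin \o 'D_v F) (fun x => (C * \1_B x)%:E).
- by move=> k; exact/measurable_EFinP.
- exact/measurable_EFinP.
- by apply: aeW => x _ /=; apply: cvg_EFin => //; [exact: nearW|exact: gD].
- exact: intdom.
- by apply: aeW => x k _ /=; rewrite lee_fin; exact: gB.
split => //; move: cvD.
rewrite (_ : [sequence _]_k = cst 0%E); last by apply/funext => k /=; exact: ig.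
by move=> /(cvg_lim (@ereal_hausdorff R)) <-; rewrite lim_cst//; exact: ereal_hausdorff.
Qed.

End rV_integral.

(** * The function |t|^p *)

Section abs_power.
Variables (R : realType) (p : R).
Hypothesis p1 : 1 < p.
Implicit Types (s t a b c g F k : R).

Let p0 : 0 < p. Proof. exact: lt_trans p1. Qed.

Definition abs_pow t : R := `|t| `^ p.
Definition abs_pow' t : R := p * (Num.sg t * `|t| `^ (p - 1)).
Local Notation theta := abs_pow.
Local Notation theta' := abs_pow'.

Lemma abs_pow0 : theta 0 = 0.
Proof. by rewrite /theta normr0 powR0// gt_eqF. Qed.

Lemma abs_pow'0 : theta' 0 = 0.
Proof. by rewrite /theta' sgr0 mul0r mulr0. Qed.

Lemma abs_pow_ge0 t : 0 <= theta t.
Proof. exact: powR_ge0. Qed.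

Lemma abs_pow'_mul t : theta' t * t = p * theta t.
Proof.
rewrite /theta' /theta -mulrA; congr (_ * _).
by rewrite mulrAC -normrEsg mulr_powRB1.
Qed.

Lemma abs_pow_scale c t : 0 <= c -> theta (c * t) = c `^ p * theta t.
Proof. by move=> c0; rewrite /theta normrM ger0_norm// powRM. Qed.

Lemma abs_pow'_scale c t : 0 < c -> theta' (c * t) = c `^ (p - 1) * theta' t.
Proof.
move=> c0; have c0' := ltW c0;
  rewrite /theta' normrM gtr0_norm// powRM// sgrM gtr0_sg// mul1r; ring.
Qed.

(* Young's inequality for [|a|^(p-1)] and [|b|]. *)
Lemma abs_pow_tangent a b : theta a + theta' a * (b - a) <= theta b.
Proof.
have q0 : 0 < p / (p - 1) by rewrite divr_gt0// subr_gt0.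
have := @conjugate_powR R `|b| (`|a| `^ (p - 1)) p (p / (p - 1)) (normr_ge0 _)
  (powR_ge0 _ _) p0 q0.
rewrite -powRrM (mulrC (p - 1)) divfK ?gt_eqF ?subr_gt0// invf_div.
have pne : p != 0 by rewrite gt_eqF.
have -> : p^-1 + (p - 1) / p = 1 by field.
rewrite -/(theta a) -/(theta b) => /(_ erefl) Y.
have {}Y : p * (`|a| `^ (p - 1) * `|b|) <= theta b + (p - 1) * theta a.
  have -> : theta b + (p - 1) * theta a = p * (theta b / p + theta a * ((p - 1) / p))
    by field.
  by rewrite ler_pM2l// mulrC.
have h : theta' a * b <= p * (`|a| `^ (p - 1) * `|b|).
  rewrite /theta' -mulrA; apply: ler_wpM2l; first exact: ltW.
  rewrite mulrAC mulrC; apply: ler_wpM2l; first exact: powR_ge0.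
  rewrite (le_trans (ler_norm _))// normrM normr_sg ler_piMl//.
  by case: (a != 0); rewrite ?lexx ?ler01.
have := abs_pow'_mul a; nra.
Qed.

Lemma normr_abs_pow' t : `|theta' t| <= p * `|t| `^ (p - 1).
Proof.
rewrite /theta' normrM (gtr0_norm p0); apply: ler_wpM2l; first exact: ltW.
rewrite normrM normr_sg (ger0_norm (powR_ge0 _ _)) ler_piMl ?powR_ge0//.
by case: (t != 0); rewrite ?lexx ?ler01.
Qed.

(** Convexity suffices: the tangent line at [a] bounds theta a - theta b by theta' a * (a - b), and
    exchanging the points bounds the other sign. *)
Lemma abs_pow_lip B s t : `|s| <= B -> `|t| <= B ->
  `|theta s - theta t| <= p * B `^ (p - 1) * `|s - t|.
Proof.
move=> sB tB; have key a b : `|a| <= B -> `|b| <= B ->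
  theta a - theta b <= p * B `^ (p - 1) * `|a - b|.
  move=> aB bB; have := abs_pow_tangent a b.
  have : - (theta' a * (b - a)) <= p * B `^ (p - 1) * `|a - b|.
    rewrite -mulrN opprB (le_trans (ler_norm _))// normrM; apply: ler_wpM2r => //.
    apply: (le_trans (normr_abs_pow' a)); apply: ler_wpM2l; first exact: ltW.
    apply: ge0_ler_powR => //; first by rewrite subr_ge0 ltW.
    by rewrite nnegrE (le_trans _ aB).
  by move=> h1 h2; lra.
rewrite ler_norml key// andbT lerNl opprB.
by rewrite -normrN opprB key.
Qed.

Lemma continuous_abs_pow : continuous theta.
Proof.
move=> t; have [M0 hM] : exists2 M, 0 < M & `|t| + 1 <= M by exists (`|t| + 1) => //;
  rewrite ltr_wpDl.
move=> tM; pose K := p * M0 `^ (p - 1) + 1.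
have K0 : 0 < K by rewrite ltr_wpDl// mulr_ge0 ?powR_ge0 ?ltW.
apply/cvgrPdist_le => e e0; near=> s.
have st1 : `|t - s| < 1 by near: s; exact: cvgr_dist_lt.
have ste : `|t - s| <= e / K by near: s; apply: cvgr_dist_le => //; exact: divr_gt0.
have sM : `|s| <= M0.
  apply: le_trans tM; rewrite -[s](subKr t) (le_trans (ler_normB _ _))// lerD2l ltW//.
have tM' : `|t| <= M0 by apply: le_trans tM; rewrite lerDl.
rewrite (le_trans (abs_pow_lip tM' sM))// (le_trans (y := K * `|t - s|))//.
  by apply: ler_wpM2r => //; rewrite /K lerDl.
by rewrite mulrC -ler_pdivlMr.
Unshelve. all: by end_near. Qed.

Lemma is_derive_abs_pow t : is_derive t 1 theta (theta' t).
Proof.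
have [t0|t0|->] := ltgtP t 0.
- have h : is_derive t 1 (fun s : R => (- s) `^ p) (theta' t).
    have t0' : 0 < - t by rewrite oppr_gt0.
    have h1 := is_derive1_powR p t0'.
    have h2 := is_derive1_comp h1 (is_deriveNid t (1 : R)).
    apply: is_derive_eq h2 _.
    by rewrite /theta' ltr0_sg// ltr0_norm// mulrN1 mulN1r mulrN.
  apply: near_eq_is_derive h; near=> s.
  by rewrite /theta ltr0_norm//; near: s; exact: lt_nbhsl.
- have h := is_derive1_powR p t0.
  have {}h : is_derive t 1 (fun s : R => s `^ p) (theta' t).
    apply: is_derive_eq h _; by rewrite /theta' gtr0_sg// gtr0_norm// mul1r.
  apply: near_eq_is_derive h; near=> s.
  by rewrite /theta gtr0_norm//; near: s; exact: lt_nbhsr.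
- rewrite abs_pow'0; suff h : (fun h : R => h^-1 *:
  ((theta \o shift 0) (h *: (1 : R)) - theta 0)) @ 0^' --> (0 : R).
    by apply: DeriveDef; [apply/cvg_ex; exists 0; exact: h|exact: (cvg_lim _ h)].
  apply/cvgr0Pnorm_le => e e0.
  have q0 : 0 < (p - 1)^-1 by rewrite invr_gt0 subr_gt0.
  (* At 0 the quotient has absolute value |h|^(p-1), which is at most [e] below this threshold. *)
  have nq : \forall h \near (0 : R), `|h| < e `^ (p - 1)^-1.
    apply/nbhs_ballP; exists (e `^ (p - 1)^-1) => /=; first exact: powR_gt0.
    by move=> h; rewrite -ball_normE /= sub0r normrN.
  near=> h; rewrite /= addr0 abs_pow0 subr0 [h *: 1]mulr1 normrM normfV.
  rewrite (ger0_norm (abs_pow_ge0 _)) /theta -mulr_powRB1// mulKf ?normr_eq0.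
    have hr : `|h| <= e `^ (p - 1)^-1.
      by apply/ltW; near: h; exact: nbhs_dnbhs.
    apply: (@le_trans _ _ ((e `^ (p - 1)^-1) `^ (p - 1))).
      by apply: ge0_ler_powR; rewrite ?nnegrE ?powR_ge0// subr_ge0 ltW.
    have e0' := ltW e0; by rewrite -powRrM mulVf ?gt_eqF ?subr_gt0// powRr1.
  by near: h; exact: nbhs_dnbhs_neq.
Unshelve. all: by end_near. Qed.

(* The tangent line inequality at the point [(p - 1) / p * F]. *)
Lemma abs_pow_hardy g F k :
  ((p - 1) / p) `^ p * ((1 - p * k / (p - 1)) * theta F) <=
  theta g - ((p - 1) / p) `^ (p - 1) * (theta' F * g - p * theta F + theta F * (1 + k)).
Proof.
set c := (p - 1) / p; have c0 : 0 < c by rewrite divr_gt0// subr_gt0.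
have pm : p - 1 != 0 by rewrite gt_eqF// subr_gt0.
have := abs_pow_tangent (c * F) g.
have c0' := ltW c0; rewrite abs_pow_scale// abs_pow'_scale//.
have -> : c `^ p = c * c `^ (p - 1) by rewrite mulr_powRB1// ltW.
have tF := abs_pow'_mul F; set T := theta F in tF *; set G := theta g.
set T' := theta' F in tF *; set u := c `^ (p - 1).
have E1 : c * u * ((1 - p * k / (p - 1)) * T) = u * (c * T - k * T).
  rewrite /c; field; rewrite pm andbT gt_eqF//.
have E2 : c * u * T + u * T' * (g - c * F) = u * (T' * g) + u * (c * T - c * (T' * F))
  by ring.
rewrite E1 E2 tF; have -> : c * (p * T) = (p - 1) * T by rewrite mulrA divfK// gt_eqF.
lra.
Qed.

Lemma measurable_abs_pow' : measurable_fun setT theta'.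
Proof.
have pm : p - 1 != 0 by rewrite gt_eqF// subr_gt0.
(* Positive and negative parts replace the sign function; this uses that 0 to the nonzero power p -
   1 is 0. *)
rewrite (_ : theta' = fun t => p * (Num.max t 0 `^ (p - 1) - Num.max (- t) 0 `^ (p - 1)));
  last first.
  apply/funext => t; rewrite /theta' /abs_pow'; congr (_ * _).
  have [t0|t0|->] := ltgtP t 0.
  - rewrite ltr0_sg// ltr0_norm// max_l; last by rewrite oppr_ge0 ltW.
    by rewrite powR0// sub0r mulN1r.
  - rewrite gtr0_sg// gtr0_norm// max_r; last by rewrite oppr_le0 ltW.
    by rewrite powR0// subr0 mul1r.
  - by rewrite sgr0 mul0r oppr0 maxxx subrr.
have m1 : measurable_fun setT (fun x : R => Num.max x 0) by exact: measurable_maxr.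
have m2 : measurable_fun setT (fun x : R => Num.max (- x) 0).
  by apply: measurable_maxr => //; exact: oppr_measurable.
apply: measurable_funM => //; apply: measurable_funB.
  exact: measurableT_comp (@measurable_powR R (p - 1)) m1.
exact: measurableT_comp (@measurable_powR R (p - 1)) m2.
Qed.

Lemma abs_pow_div a b : 0 < b -> theta (a / b) = `|a| `^ p / b `^ p.
Proof.
move=> b0; have b0' := ltW b0; have bV : 0 <= b^-1 by rewrite invr_ge0.
rewrite /theta normrM (ger0_norm bV) powRM//; congr (_ * _).
have bp : b `^ p != 0 by rewrite gt_eqF// powR_gt0.
by apply: (mulIf bp); rewrite mulVf// -powRM// mulVf ?gt_eqF// powR1.
Qed.

End abs_power.

(** * The Hardy inequality *)

Section hardy.
Variables (R : realType) (n : nat) (Omega : set 'rV[R]_n).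
Hypotheses (n_gt0 : (0 < n)%N) (Omega_open : open Omega) (Omega_nT : ~` Omega !=set0).
Hypothesis ridge_closed : exists2 C : set 'rV[R]_n,
     closed C & ridge Omega = Omega `&` C.
Hypothesis Omega_C2 : C2_boundary Omega.
Variables (p : R) (f : 'rV[R]_n -> R).
Hypothesis p1 : 1 < p.
Local Notation D := (Omega `\` ridge Omega).
Hypothesis hf : test_function D f.
Implicit Types (x y z v w : 'rV[R]_n) (t h : R).
Local Notation N := (near_point Omega).
Local Notation delta := (delta Omega).
Local Notation K := (fsupport f).
Local Notation e_ i := (delta_mx ord0 i : 'rV[R]_n).
Local Notation theta := (abs_pow p).
Local Notation theta' := (abs_pow' p).

Let oD : open D. Proof. exact: open_off_ridge. Qed.
Let nD x : D x -> nbhs x D. Proof. by move=> xD; exact: open_nbhs_nbhs. Qed.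
Let cK : compact K. Proof. by case: hf. Qed.
Let KD x : K x -> D x. Proof. by case: hf => _ _; exact. Qed.
Let clK : closed K. Proof. exact: closed_closure. Qed.
Let d_gt0 x : D x -> 0 < delta x.
Proof. by case => xO _; exact: delta_gt0. Qed.

Lemma off_fsupport x : ~ K x -> f x = 0.
Proof.
move=> xK; apply/eqP/negPn/negP => fx; apply: xK; exact: subset_closure.
Qed.

Lemma near_off_fsupport x : ~ K x -> \forall y \near x, ~ K y.
Proof. by move=> xK; apply: open_nbhs_nbhs; split => //; exact: closed_openC. Qed.

Lemma derive_off_fsupport (g : 'rV[R]_n -> R) x v : (forall y, ~ K y -> g y = 0) ->
  ~ K x -> 'D_v g x = 0.
Proof.
move=> g0 xK; rewrite (@near_eq_derive _ _ _ g (cst 0)) ?derive_cst//.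
by apply: filterS (near_off_fsupport xK) => y /g0.
Qed.

(** Nothing is known of delta or [N] on the ridge, but a point outside [D] has a neighbourhood
    missing the closed support, where [g] is 0. *)
Lemma differentiable_glue (g : 'rV[R]_n -> R) : (forall y, ~ K y -> g y = 0) ->
  (forall x, D x -> differentiable g x) -> forall x, differentiable g x.
Proof.
move=> g0 dg x; have [/dg//|xD] := pselect (D x).
have xK : ~ K x by move/KD.
apply: (@near_eq_differentiable _ _ _ _ (cst 0)) => //.
by apply: filterS (near_off_fsupport xK) => y /g0.
Qed.

Lemma continuous_glue (g : 'rV[R]_n -> R) : (forall y, ~ K y -> g y = 0) ->
  (forall x, D x -> {for x, continuous g}) -> continuous g.
Proof.
move=> g0 cg x; have [/cg//|xD] := pselect (D x).
have xK : ~ K x by move/KD.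
apply: differentiable_continuous; apply: (@near_eq_differentiable _ _ _ _ (cst 0)) => //.
by apply: filterS (near_off_fsupport xK) => y /g0.
Qed.

Lemma test_function_C1 : Ck_on setT 1 f. Proof. by case: hf. Qed.

Lemma test_function_differentiable x : differentiable f x.
Proof. by apply: (differentiable_C1 openT test_function_C1). Qed.

Lemma continuous_delta (A : set 'rV[R]_n) : ~` A !=set0 -> continuous (Defs.delta A).
Proof.
move=> A0; have lip y z : `|Defs.delta A y - Defs.delta A z| <= n%:R * `|y - z|.
  rewrite ler_norml; apply/andP; split.
    rewrite lerNl opprB lerBlDl (le_trans (delta_lip A0 z y))// lerD2l distrC.
    exact: enorm_le_norm.
  by rewrite lerBlDl (le_trans (delta_lip A0 y z))// lerD2l; exact: enorm_le_norm.
move=> x B /nbhs_ballP[e /= e0 eB]; have c0 : 0 < n%:R + 1 :> R by rewrite ltr_wpDl.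
apply/nbhs_ballP; exists (e / (n%:R + 1)) => /=; first exact: divr_gt0.
move=> y; rewrite -ball_normE /= => xy; apply: eB; rewrite -ball_normE /=.
apply: (le_lt_trans (lip x y)); move: xy; rewrite ltr_pdivlMr//; apply: le_lt_trans.
by rewrite mulrC ler_wpM2l// lerDl.
Qed.

Lemma support_bounds : exists m M rho : R, [/\ 0 < m, 0 < M, 0 < rho &
  forall x, K x -> [/\ `|x| <= M, m <= delta x, delta x <= M & ball x rho `<=` D]].
Proof.
have [M1 [_ hM1]] := compact_bounded cK.
pose M0 := `|M1| + 1; have M0K x : K x -> `|x| <= M0.
  by move=> Kx; apply: (hM1 M0) => //; rewrite ltr_pwDr// ler_norm.
have D0 : ~` D !=set0 by have [z zO] := Omega_nT; exists z; case.
have [m m0 hm] : exists2 m, 0 < m & forall x, K x -> m <= Defs.delta D x.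
  have [[x0 Kx0]|K0] := pselect (K !=set0); last first.
    by exists 1 => // x Kx; exfalso; apply: K0; exists x.
  have [x] := @EVT_min_rV _ _ (Defs.delta D) K (ex_intro _ _ Kx0) cK
     (continuous_subspaceT (continuous_delta D0)).
  rewrite inE => Kx xmin; exists (Defs.delta D x); first exact: delta_gt0 (KD Kx).
  by move=> y Ky; apply: xmin; rewrite inE.
(* Bounds delta on the support through delta x <= delta 0 + |x|, with the Euclidean norm at most [n]
   times the sup norm. *)
pose M := M0 + delta 0 + n%:R * M0; have M00 : 0 < M0 by rewrite ltr_wpDl.
have n1 : 0 < n%:R + 1 :> R by rewrite ltr_wpDl.
exists m, M, (m / (n%:R + 1)); split => //.
- by rewrite /M -addrA ltr_wpDr// addr_ge0 ?delta_ge0// mulr_ge0// ltW.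
- exact: divr_gt0.
move=> x Kx; split.
- by rewrite (le_trans (M0K _ Kx))// /M -addrA lerDl addr_ge0 ?delta_ge0// mulr_ge0// ltW.
- apply: (le_trans (hm _ Kx)); apply: (le_delta Omega_nT) => z zO.
  by apply: delta_le => //; case.
- have h1 := delta_lip Omega_nT x 0; rewrite subr0 in h1.
  have h2 : enorm x <= n%:R * M0.
    by rewrite (le_trans (enorm_le_norm _))// ler_wpM2l// M0K.
  rewrite /M; lra.
- move=> z; rewrite -ball_normE /= => xz; apply: contrapT => zD.
  have := le_trans (hm _ Kx) (delta_le D0 x zD); apply/negP; rewrite -ltNge.
  rewrite (le_lt_trans (enorm_le_norm _))//; move: xz; rewrite ltr_pdivlMr// distrC;
    apply: le_lt_trans.
  by rewrite mulrC ler_wpM2l// lerDl.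
Qed.

Definition hardy_ratio x : R := f x / delta x.
Local Notation F := hardy_ratio.

(* [|f|^p delta^(1-p) grad delta], as [grad delta = (x - N x) / delta]. *)
Definition hardy_field i x : R := theta (F x) * (x - N x) ord0 i.

(** [grad delta . grad f] with the gradient of delta replaced by its value off the ridge, a form
    whose continuity is visible. *)
Definition radial_derive x : R := \sum_i (x - N x) ord0 i / delta x * 'D_(e_ i) f x.

Lemma hardy_ratio_off x : ~ K x -> F x = 0.
Proof. by move=> /off_fsupport; rewrite /F => ->; rewrite mul0r. Qed.

Lemma abs_pow_ratio_off x : ~ K x -> theta (F x) = 0.
Proof. by move=> /hardy_ratio_off ->; exact: abs_pow0. Qed.

Lemma hardy_field_off i x : ~ K x -> hardy_field i x = 0.
Proof. by move=> xK; rewrite /hardy_field abs_pow_ratio_off// mul0r. Qed.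

Lemma radial_derive_off x : ~ K x -> radial_derive x = 0.
Proof.
move=> xK; rewrite /radial_derive big1// => i _.
by rewrite (derive_off_fsupport _ off_fsupport xK) mulr0.
Qed.

Lemma is_derive_hardy_ratio x v : D x ->
  is_derive x v F ('D_v f x / delta x - F x * (dotp (x - N x) v / delta x ^+ 2)).
Proof.
move=> xD; have dne : delta x != 0 by rewrite gt_eqF// d_gt0.
have df := derivableP (diff_derivable (test_function_differentiable x) : derivable f x v).
have dd : is_derive x v delta (dotp (x - N x) v / delta x) by exact: is_derive_delta.
have [ddx dde] := dd.
have dV : is_derive x v (fun y => (delta y)^-1)
  (- delta x ^- 2 *: (dotp (x - N x) v / delta x)).
  by apply: DeriveDef; [exact: derivableV|rewrite deriveV// dde].
apply: is_derive_eq (is_deriveM df dV) _.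
rewrite -[LHS]/(f x * (- delta x ^- 2 * (dotp (x - N x) v / delta x)) + (delta x)^-1 *
  'D_v f x) /F.
by field.
Qed.

Lemma differentiable_hardy_ratio x : D x -> differentiable F x.
Proof.
move=> xD; apply: differentiableM; first exact: test_function_differentiable.
apply: differentiableV; last by rewrite gt_eqF// d_gt0.
exact: differentiable_delta.
Qed.

Lemma differentiable_abs_pow_ratio x : D x -> differentiable (theta \o F) x.
Proof.
move=> xD; apply: differentiable_comp; first exact: differentiable_hardy_ratio.
by apply/derivable1_diffP; case: (is_derive_abs_pow p1 (F x)).
Qed.

Lemma near_point_diff x : D x -> differentiable N x.
Proof.
by move=> xD; have [] := near_point_differentiable Omega_open Omega_nT ridge_closed
  Omega_C2 xD.
Qed.

Lemma differentiable_offset_coord i x : D x ->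
  differentiable (fun x => (x - N x) ord0 i : R) x.
Proof.
move=> xD; apply: (@differentiable_comp _ _ _ _ (fun x => x - N x)
  (fun y : 'rV[R]_n => y ord0 i : R)).
  by apply: differentiableB => //; exact: near_point_diff.
exact: differentiable_coord.
Qed.

Lemma differentiable_hardy_field i x : differentiable (hardy_field i) x.
Proof.
apply: differentiable_glue; first exact: hardy_field_off.
move=> {}x xD; apply: differentiableM; first exact: differentiable_abs_pow_ratio.
exact: differentiable_offset_coord.
Qed.

Lemma derive_hardy_field i x : D x ->
  'D_(e_ i) (hardy_field i) x = theta' (F x) *
    ('D_(e_ i) f x / delta x - F x * ((x - N x) ord0 i / delta x ^+ 2))
    * (x - N x) ord0 i + theta (F x) * (1 - ('d N x (e_ i)) ord0 i).
Proof.
move=> xD; have dF := is_derive_hardy_ratio (e_ i) xD; rewrite dotp_delta in dF.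
set dFx := ('D_(e_ i) f x / delta x - _) in dF *.
have dtF : is_derive x (e_ i) (theta \o F) (theta' (F x) * dFx).
  apply: DeriveDef; first by apply: diff_derivable; exact: differentiable_abs_pow_ratio.
  have dFd := differentiable_hardy_ratio xD.
  have dth : differentiable theta (F x).
    by apply/derivable1_diffP; case: (is_derive_abs_pow p1 (F x)).
  rewrite deriveE; last exact: differentiable_abs_pow_ratio.
  rewrite diff_comp//= -(deriveE _ dFd); have [_ ->] := dF.
  rewrite -[dFx in LHS]mulr1 -[dFx * 1]/(dFx *: (1 : R)) linearZ /= -deriveE//.
  by have [_ ->] := is_derive_abs_pow p1 (F x); rewrite mulrC.
have dc : is_derive x (e_ i) (fun x => (x - N x) ord0 i : R) (1 - ('d N x (e_ i)) ord0 i).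
  have h : is_derive x (e_ i) (fun x => x - N x) (e_ i - 'd N x (e_ i)).
    apply: is_deriveB; rewrite -deriveE; last exact: near_point_diff.
    by apply/derivableP/diff_derivable/near_point_diff.
  by apply: is_derive_eq (is_derive_coord i h) _; rewrite !mxE !eqxx.
have [_ ->] := is_deriveM dtF dc.
rewrite -[LHS]/(theta (F x) * (1 - ('d N x (e_ i)) ord0 i) + (x - N x) ord0 i *
  (theta' (F x) * dFx)).
by rewrite addrC [(x - N x) ord0 i * _]mulrC.
Qed.

Lemma div_hardy_field x (kappa : 'I_n.-1 -> R) : D x ->
  principal_curvatures Omega (N x) kappa ->
  \sum_i 'D_(e_ i) (hardy_field i) x = theta' (F x) * radial_derive x - p * theta (F x)
     + theta (F x) * (1 + delta x * kappa_tilde Omega kappa x).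
Proof.
move=> xD hk; have dne : delta x != 0 by rewrite gt_eqF// d_gt0.
under eq_bigr do rewrite (derive_hardy_field _ xD).
rewrite big_split /= -mulr_sumr sumrB
  (near_point_trace Omega_open Omega_nT ridge_closed Omega_C2 xD hk).
have -> : \sum_(i < n) (1 : R) = n.-1%:R + 1.
  by rewrite sumr_const card_ord -{1}(prednK n_gt0) -addn1 natrD.
congr (_ + _); last by congr (_ * _); ring.
rewrite -(abs_pow'_mul p1) -mulrBr.
under eq_bigr do rewrite -mulrA; rewrite -mulr_sumr; congr (_ * _).
(* |x - N x|^2 = delta^2 turns the radial part of the derivative of [F] into the scalar [F x]. *)
have S1 : \sum_i (x - N x) ord0 i * (x - N x) ord0 i / delta x ^+ 2 = 1.
  rewrite -mulr_suml -[X in X / _]/(dotp (x - N x) (x - N x)).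
  by rewrite -(delta_sqr Omega_open Omega_nT xD.1) divff// expf_eq0.
rewrite -[F x in RHS]mulr1 -S1 mulr_sumr /radial_derive -sumrB; apply: eq_bigr => i _.
by field.
Qed.

Lemma test_function_derive_bound i : exists2 C, 0 < C & forall x, `|'D_(e_ i) f x| <= C.
Proof.
have [_ /(_ i)[_ [cd _]]] := test_function_C1.
have cdi : continuous ('D_(e_ i) f) by move=> x; exact: cd.
have [C [_ hC]] : bounded_set ('D_(e_ i) f @` K).
  by apply: compact_bounded; apply: continuous_compact => //; exact: continuous_subspaceT.
exists (`|C| + 1); first by rewrite ltr_wpDl.
move=> x; have [Kx|xK] := pselect (K x); last first.
  by rewrite (derive_off_fsupport _ off_fsupport xK) normr0 addr_ge0.
by apply: (hC (`|C| + 1)); [rewrite ltr_pwDr// ler_norm|exists x].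
Qed.

Lemma test_function_lip i : exists2 C, 0 < C & forall x h,
  `|f (x + h *: e_ i) - f x| <= C * `|h|.
Proof.
have [C C0 hC] := test_function_derive_bound i; exists C => // x h.
have [|s _ E] := @mvt_line _ _ f (e_ i) x h.
  by move=> s _; apply: diff_derivable; exact: test_function_differentiable.
by rewrite (addrC x) E normrM mulrC ler_wpM2r.
Qed.

Lemma test_function_bound : exists2 C, 0 < C & forall x, `|f x| <= C.
Proof.
have cf : continuous f by move=> x;
  exact/differentiable_continuous/test_function_differentiable.
have [C [_ hC]] : bounded_set (f @` K).
  by apply: compact_bounded; apply: continuous_compact => //; exact: continuous_subspaceT.
exists (`|C| + 1); first by rewrite ltr_wpDl.
move=> x; have [Kx|/off_fsupport ->] := pselect (K x); last by rewrite normr0 addr_ge0.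
by apply: (hC (`|C| + 1)); [rewrite ltr_pwDr// ler_norm|exists x].
Qed.

Lemma enorm_scale_delta i h : enorm (h *: e_ i) = `|h|.
Proof. by rewrite enormZ /enorm dotp_delta mxE !eqxx sqrtr1 mulr1. Qed.

(** The bound must hold for all pairs of points. Between two support points, [near_point_lip_on]
    controls [N] at any distance; otherwise at least one value of the field is 0. *)
Lemma hardy_field_lip i : exists C, forall x h,
  `|hardy_field i (x + h *: e_ i) - hardy_field i x| <= C * `|h|.
Proof.
have [m [M [rho [m0 M0 rho0 hK]]]] := support_bounds.
have [Cf Cf0 hCf] := test_function_lip i; have [Bf Bf0 hBf] := test_function_bound.
pose B := Bf / m; have B0 : 0 < B by exact: divr_gt0.
pose CF := Cf / m + Bf / m ^+ 2; have CF0 : 0 < CF.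
  by rewrite addr_gt0// divr_gt0// exprn_gt0.
pose L := p * B `^ (p - 1).
have L0 : 0 <= L by rewrite mulr_ge0 ?powR_ge0// ltW// (lt_trans ltr01).
pose CN := 1 + 2 * M / rho; have CN0 : 0 < CN by rewrite addr_gt0// divr_gt0// mulr_gt0.
have FB x : `|F x| <= B.
  have [Kx|/hardy_ratio_off ->] := pselect (K x); last by rewrite normr0 ltW.
  have [_ md _ _] := hK _ Kx; have dx : 0 < delta x by exact: lt_le_trans md.
  rewrite /F normrM normfV (gtr0_norm dx); apply: ler_pM => //;
    first by rewrite invr_ge0 ltW.
  by rewrite lef_pV2 ?posrE.
have Flip x h : K x -> `|F (x + h *: e_ i) - F x| <= CF * `|h|.
  move=> Kx; have [_ md _ _] := hK _ Kx; have dx : 0 < delta x by exact: lt_le_trans md.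
  have fh := hCf x h; set x' := x + h *: e_ i in fh *.
  have CFh : Cf / m * `|h| <= CF * `|h| by rewrite ler_wpM2r// lerDl divr_ge0//
    ?exprn_ge0// ltW.
  have [Kx'|x'K] := pselect (K x'); last first.
    rewrite (hardy_ratio_off x'K) sub0r normrN; apply: le_trans CFh.
    move: fh; rewrite (off_fsupport x'K) sub0r normrN => fh.
    rewrite /F normrM normfV (gtr0_norm dx) mulrAC; apply: ler_pM => //.
      by rewrite invr_ge0 ltW.
    by rewrite lef_pV2 ?posrE.
  have [_ md' _ _] := hK _ Kx'; have dx' : 0 < delta x' by exact: lt_le_trans md'.
  have dd : `|delta x - delta x'| <= `|h|.
    have e1 : enorm (x - x') = `|h| by rewrite /x' opprD addNKr enormN enorm_scale_delta.
    rewrite ler_norml; apply/andP; split.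
      by rewrite lerNl opprB lerBlDl (le_trans (delta_lip Omega_nT x' x))// enorm_distC e1.
    by rewrite lerBlDl (le_trans (delta_lip Omega_nT x x'))// e1.
  have -> : F x' - F x = (f x' - f x) / delta x' + f x * (delta x - delta x') /
    (delta x * delta x').
    by rewrite /F; field; rewrite !gt_eqF.
  rewrite (le_trans (ler_normD _ _))// /CF [leRHS]mulrDl; apply: lerD.
    rewrite normrM normfV (gtr0_norm dx') [leRHS]mulrAC; apply: ler_pM => //.
      by rewrite invr_ge0 ltW.
    by rewrite lef_pV2 ?posrE.
  rewrite !normrM normfV (gtr0_norm (mulr_gt0 dx dx')) [leRHS]mulrAC; apply: ler_pM => //.
  - by rewrite invr_ge0 mulr_ge0// ltW.
  - exact: ler_pM.
  - rewrite lef_pV2 ?posrE ?exprn_gt0 ?mulr_gt0// expr2; apply: ler_pM => //; exact: ltW.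
have LB : 0 <= L * B by rewrite mulr_ge0// ltW.
have L1 : 0 <= 1 + CN by rewrite addr_ge0// ltW.
exists (L * CF * M + L * B * (1 + CN)).
have main x h : K x -> `|hardy_field i (x + h *: e_ i) - hardy_field i x|
  <= (L * CF * M + L * B * (1 + CN)) * `|h|.
  move=> Kx; have [_ md dM rD] := hK _ Kx; have := Flip x h Kx.
  set x' := x + h *: e_ i => FF.
  have tt : `|theta (F x') - theta (F x)| <= L * CF * `|h|.
    apply: (le_trans (abs_pow_lip p1 (FB x') (FB x))); rewrite -[leRHS]mulrA;
      exact: ler_wpM2l.
  have cx : `|(x - N x) ord0 i| <= M.
    rewrite (le_trans (coord_le_norm _ _))// (le_trans (norm_le_enorm _))//.
    by rewrite -(delta_near_point Omega_open Omega_nT (KD Kx).1).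
  have tB : `|theta (F x')| <= L * B.
    have := abs_pow_lip p1 (FB x') (t := 0);
      rewrite normr0 (abs_pow0 p1) !subr0 => /(_ (ltW B0)).
    by move=> /le_trans; apply; rewrite ler_wpM2l.
  (* The variation of [x - N x] is multiplied by [theta (F x')], which vanishes when [x'] is off the
     support, so [N] is compared only between support points. *)
  have E (a b c d : R) : a * b - c * d = (a - c) * d + a * (b - d) by ring.
  rewrite /hardy_field E.
  rewrite (le_trans (ler_normD _ _))// [leRHS]mulrDl; apply: lerD.
    by rewrite normrM [leRHS]mulrAC; apply: ler_pM.
  have [Kx'|x'K] := pselect (K x'); last first.
    rewrite (abs_pow_ratio_off x'K) mul0r normr0; apply: mulr_ge0 => //.
    exact: mulr_ge0.
  rewrite normrM -mulrA; apply: ler_pM => //.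
  have [_ _ dM' rD'] := hK _ Kx'.
  have E1 (y z u v : 'rV[R]_n) :
    (y - u) ord0 i - (z - v) ord0 i = (y - z - (u - v)) ord0 i by rewrite !mxE; ring.
  have E2 : x' - x = h *: e_ i by rewrite /x' addrAC subrr add0r.
  rewrite E1 E2 (le_trans (coord_le_norm _ _))// (le_trans (norm_le_enorm _))//.
  rewrite (le_trans (enormD _ _))// enormN enorm_scale_delta mulrDl mul1r lerD2l.
  have := near_point_lip_on Omega_open Omega_nT rho0 M0 rD rD' dM dM'.
  by rewrite E2 enorm_scale_delta.
move=> x h; have [Kx|xK] := pselect (K x); first exact: main.
(* Only the endpoint is in the support: apply [main] from there with step [- h]. *)
have [Kx'|x'K] := pselect (K (x + h *: e_ i)).
  have := main _ (- h) Kx'; have -> : x + h *: e_ i + (- h) *: e_ i = x.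
    by rewrite scaleNr addrK.
  rewrite normrN => h1; rewrite distrC; exact: h1.
rewrite (hardy_field_off _ xK) (hardy_field_off _ x'K) subrr normr0.
have LCM : 0 <= L * CF * M by rewrite mulr_ge0 ?(ltW M0)// mulr_ge0// ltW.
by apply: mulr_ge0 => //; apply: addr_ge0 => //; apply: mulr_ge0.
Qed.

Local Notation mu := (lebesgue_rV R n).
Local Notation div x := (\sum_i 'D_(e_ i) (hardy_field i) x).

Lemma support_norm_le : exists M, forall x, K x -> `|x| <= M.
Proof. by have [m [M [rho [_ _ _ h]]]] := support_bounds; exists M => x /h[]. Qed.

Lemma integrable_fsupport (g : 'rV[R]_n -> R) :
  continuous g -> (forall x, ~ K x -> g x = 0) ->
  mu.-integrable setT (EFin \o g).
Proof.
move=> cg g0; have [M hM] := support_norm_le.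
apply: (integrable_continuous_csupp (M := M) cg) => x gx; apply: hM.
by apply: contrapT => /g0 gx0; rewrite gx0 eqxx in gx.
Qed.

Lemma integral_div_hardy_field : mu.-integrable setT (EFin \o (fun x => div x)) /\
  (\int[mu]_x (div x)%:E = 0)%E.
Proof.
have [M hM] := support_norm_le.
have h i : mu.-integrable setT (EFin \o 'D_(e_ i) (hardy_field i)) /\
    (\int[mu]_x ('D_(e_ i) (hardy_field i) x)%:E = 0)%E.
  have [C hC] := hardy_field_lip i.
  apply: (@integral_derive_csupp _ _ _ _ C M) => //.
  - by move=> x; exact/differentiable_continuous/differentiable_hardy_field.
  - move=> x gx; apply: hM.
    by apply: contrapT => /(hardy_field_off i) gx0; rewrite gx0 eqxx in gx.
  - by move=> x; exact/diff_derivable/differentiable_hardy_field.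
have E : EFin \o (fun x => div x) =
  (fun x => \sum_(i < n) ('D_(e_ i) (hardy_field i) x)%:E)%E.
  by apply/funext => x /=; rewrite sumEFin.
split.
  by rewrite E; apply: integrable_sum => // i _; exact: (h i).1.
under eq_integral do rewrite -sumEFin.
rewrite integral_sum//; last by move=> i; exact: (h i).1.
by rewrite big1// => i _; exact: (h i).2.
Qed.

Lemma continuous_abs_pow_ratio : continuous (theta \o F).
Proof.
apply: continuous_glue; first exact: abs_pow_ratio_off.
by move=> x xD; exact/differentiable_continuous/differentiable_abs_pow_ratio.
Qed.

Lemma continuous_radial_derive : continuous radial_derive.
Proof.
apply: continuous_glue; first exact: radial_derive_off.
move=> x xD.
rewrite (_ : radial_derive = \sum_(i < n)
  (fun x => (x - N x) ord0 i / delta x * 'D_(e_ i) f x)); last first.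
  by apply/funext => y; rewrite fct_sumE.
apply: (big_ind (fun g : 'rV[R]_n -> R => {for x, continuous g})).
- by apply: differentiable_continuous; exact: differentiable_cst.
- by move=> g1 g2 c1 c2; exact: continuousD.
move=> i _; apply: (@continuousM R 'rV[R]_n (fun x => (x - N x) ord0 i / delta x)
  ('D_(e_ i) f)).
  apply: differentiable_continuous; apply: differentiableM;
    first exact: differentiable_offset_coord.
  apply: differentiableV; last by rewrite gt_eqF// d_gt0.
  exact: differentiable_delta.
by have [_ /(_ i)[_ [cd _]]] := test_function_C1; exact: cd.
Qed.

Lemma continuous_hardy_ratio : continuous F.
Proof.
apply: continuous_glue; first exact: hardy_ratio_off.
by move=> x xD; exact/differentiable_continuous/differentiable_hardy_ratio.
Qed.

(** [theta'] is known here to be measurable and bounded on the range of [F]; domination by a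
    multiple of the continuous, compactly supported [radial_derive] suffices. *)
Lemma integrable_abs_pow'_radial :
  mu.-integrable setT (EFin \o (fun x => theta' (F x) * radial_derive x)).
Proof.
have p0 : 0 < p by exact: lt_trans p1.
have [B B0 hB] : exists2 B, 0 < B & forall x, `|F x| <= B.
  have [Bf Bf0 hf'] := test_function_bound;
    have [m [M [rho [m0 _ _ hK]]]] := support_bounds.
  exists (Bf / m); first exact: divr_gt0.
  move=> x; have [Kx|/hardy_ratio_off ->] := pselect (K x);
    last by rewrite normr0 ltW// divr_gt0.
  have [_ md _ _] := hK _ Kx; have dx : 0 < delta x by exact: lt_le_trans md.
  rewrite /F normrM normfV (gtr0_norm dx); apply: ler_pM => //;
    first by rewrite invr_ge0 ltW.
  by rewrite lef_pV2 ?posrE.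
have L0 : 0 <= p * B `^ (p - 1) by rewrite mulr_ge0 ?powR_ge0// ltW.
have mF : measurable_fun setT F := continuous_measurable_rV continuous_hardy_ratio.
have mr : measurable_fun setT radial_derive :=
  continuous_measurable_rV continuous_radial_derive.
apply: (@le_integrable _ _ _ mu setT measurableT _
  (fun x => (p * B `^ (p - 1))%:E * (radial_derive x)%:E)%E).
- apply/measurable_EFinP; apply: measurable_funM => //.
  exact: measurableT_comp (measurable_abs_pow' p1) mF.
- move=> x _; rewrite -EFinM /= lee_fin (normrM (theta' (F x)))
  (normrM (p * B `^ (p - 1))) ler_wpM2r//.
  rewrite (ger0_norm L0) (le_trans (normr_abs_pow' p1 _))//.
  rewrite ler_wpM2l ?(ltW p0)//; apply: ge0_ler_powR; rewrite ?nnegrE ?(ltW B0)//.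
  by rewrite subr_ge0 ltW.
- apply: integrableZl => //; apply: integrable_fsupport;
  first exact: continuous_radial_derive.
  exact: radial_derive_off.
Qed.

Lemma radial_deriveE x : D x -> dotp (grad delta x) (grad f x) = radial_derive x.
Proof.
move=> xD; apply: eq_bigr => i _; rewrite !mxE.
have [_ ->] := is_derive_delta Omega_open Omega_nT ridge_closed Omega_C2 (e_ i) xD.
by rewrite dotp_delta !mxE.
Qed.

Lemma grad_off x : ~ K x -> dotp (grad delta x) (grad f x) = 0.
Proof.
move=> xK; rewrite /dotp big1// => i _; rewrite !mxE.
by rewrite (derive_off_fsupport _ off_fsupport xK) mulr0.
Qed.

(** Outside [D] the gradient of delta may be meaningless, but [grad f] is 0 there. *)
Lemma dotp_grad_delta x : dotp (grad delta x) (grad f x) = radial_derive x.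
Proof.
have [/radial_deriveE//|xD] := pselect (D x).
by have xK : ~ K x by [move/KD]; rewrite grad_off// radial_derive_off.
Qed.

Lemma hardy_delta (kappa : 'rV[R]_n -> 'I_n.-1 -> R)
  (hkappa : forall x y, D x -> near_points Omega x y ->
     principal_curvatures Omega y (kappa x)) :
  ((((p - 1) / p) `^ p)%:E *
     \int[mu]_(x in Omega)
       ((1 - p * delta x * kappa_tilde Omega (kappa x) x / (p - 1)) *
        (`|f x| `^ p / delta x `^ p))%:E
   <= \int[mu]_(x in Omega) (`|dotp (grad delta x) (grad f x)| `^ p)%:E)%E.
Proof.
set c := (p - 1) / p.
have pm : p - 1 != 0 by rewrite gt_eqF// subr_gt0.
have mO : measurable Omega by exact: measurable_rV_open.
have hk x : D x -> principal_curvatures Omega (N x) (kappa x).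
  by move=> xD; apply: hkappa => //; apply: near_pointP => //; case: xD.
pose low x := (1 - p * (delta x * kappa_tilde Omega (kappa x) x) / (p - 1)) * theta (F x).
(* [div_hardy_field] solved for the curvature term. No measurability of [kappa] is given, whereas
   every term of [low'] is integrable. *)
pose low' x := theta (F x) - p / (p - 1) *
  (div x - theta' (F x) * radial_derive x + (p - 1) * theta (F x)).
have div0 x : ~ K x -> div x = 0.
  move=> xK; rewrite big1// => i _; exact: derive_off_fsupport (hardy_field_off i) xK.
have lowE x : low x = low' x.
  have [xD|xD] := pselect (D x); last first.
    have xK : ~ K x by move/KD.
    by rewrite /low /low' div0// hardy_ratio_off// abs_pow0// abs_pow'0; ring.
  rewrite /low /low' (div_hardy_field xD (hk _ xD)); field.
  by rewrite pm.
have [idiv div_int] := integral_div_hardy_field.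
have itheta : mu.-integrable setT (EFin \o (theta \o F)).
  by apply: integrable_fsupport; [exact: continuous_abs_pow_ratio|exact: abs_pow_ratio_off].
have iradial : mu.-integrable setT (EFin \o (fun x => theta (radial_derive x))).
  apply: integrable_fsupport.
    by move=> x; apply: continuous_comp;
      [exact: continuous_radial_derive|exact: continuous_abs_pow].
  by move=> x /radial_derive_off ->; exact: abs_pow0.
have ilow : mu.-integrable setT (EFin \o low).
  rewrite (_ : _ \o _ = ((EFin \o (theta \o F)) \- (fun x => (p / (p - 1))%:E *
    (((EFin \o (fun x => div x)) \- (EFin \o (fun x => theta' (F x) * radial_derive x)%R)) x
     + (p - 1)%:E * (EFin \o (theta \o F)) x)))%E); last first.
    by apply/funext => x; rewrite /= lowE /low' -!(EFinM, EFinB, EFinD).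
  apply: integrableB => //; apply: integrableZl => //; apply: integrableD => //.
    by apply: integrableB => //; exact: integrable_abs_pow'_radial.
  exact: integrableZl.
have sub (g : 'rV[R]_n -> \bar R) : mu.-integrable setT g -> mu.-integrable Omega g.
  by move=> ig; exact: (@integrableS _ _ _ mu setT Omega).
rewrite (_ : (\int[mu]_(x in Omega) _)%E = (\int[mu]_(x in Omega) (low x)%:E)%E);
  last first.
  apply: eq_integral => x; rewrite inE => xO; congr EFin.
  by rewrite /low (mulrA p) /F abs_pow_div//; exact: delta_gt0.
rewrite -integralZl//; last exact: sub.
under [leRHS]eq_integral do rewrite dotp_grad_delta -/(theta _).
(* The divergence vanishes off the support, which lies in [Omega], so this is the integral over the
   whole space. *)
have iO : (\int[mu]_(x in Omega) (div x)%:E = 0)%E.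
  rewrite integral_mkcond -[RHS]div_int; apply: eq_integral => x _; rewrite /patch.
  case: ifPn => // /negP; rewrite inE => xO; rewrite div0// => /KD [].
  exact.
(* Subtracting a multiple of a null integral reduces the claim to the pointwise inequality
   [abs_pow_hardy]. *)
have iR : (\int[mu]_(x in Omega) (theta (radial_derive x))%:E =
   \int[mu]_(x in Omega) ((theta (radial_derive x))%:E - (c `^ (p - 1))%:E * (div x)%:E))%E.
  rewrite integralB//; [|exact: sub|by apply: integrableZl => //; exact: sub].
  rewrite integralZl//; last exact: sub.
  by rewrite iO mule0 sube0.
rewrite iR; apply: le_integral => //.
- by apply: integrableZl => //; exact: sub.
- apply: integrableB => //; first exact: sub.
  by apply: integrableZl => //; exact: sub.
move=> x _; rewrite -!(EFinM, EFinB) lee_fin.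
have [xD|xD] := pselect (D x); last first.
  have xK : ~ K x by move/KD.
  by rewrite /low div0// hardy_ratio_off// radial_derive_off// abs_pow0// !mulr0 subr0.
rewrite (div_hardy_field xD (hk _ xD)).
exact: abs_pow_hardy.
Qed.

End hardy.

Unset Implicit Arguments.

Theorem corollary1 (R : realType) (n : nat) (hn : (2 <= n)%N)
  (Omega : set 'rV[R]_n)
  (Omega_open : open Omega) (Omega_conn : connected Omega)
  (Omega_C2 : C2_boundary Omega)
  (ridge_closed : exists2 C : set 'rV[R]_n,
     closed C & ridge Omega = Omega `&` C)
  (kappa : 'rV[R]_n -> 'I_n.-1 -> R)
  (hkappa : forall x y, (Omega `\` ridge Omega) x -> near_points Omega x y ->
     principal_curvatures Omega y (kappa x))
  (p : R) (hp : 1 < p)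
  (f : 'rV[R]_n -> R) (hf : test_function (Omega `\` ridge Omega) f) :
  ((((p - 1) / p) `^ p)%:E *
     \int[lebesgue_rV R n]_(x in Omega)
       ((1 - p * delta Omega x * kappa_tilde Omega (kappa x) x / (p - 1)) *
        (`|f x| `^ p / delta Omega x `^ p))%:E
   <= \int[lebesgue_rV R n]_(x in Omega)
       (`|dotp (grad (delta Omega) x) (grad f x)| `^ p)%:E)%E.
Proof.
have [nT|Omega_T] : (~` Omega) !=set0 \/ ~ (~` Omega !=set0) by exact: EM.
  exact: (hardy_delta (ltnW hn) Omega_open nT ridge_closed Omega_C2 hp hf hkappa).
(* [Omega] is the whole space: the infimum of the empty set is 0 and the inverse of 0 is 0, so the
   left side vanishes. *)
have d0 x : delta Omega x = 0.
  rewrite /delta (_ : [set _ | _ in _] = set0) ?inf0//.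
  by apply/seteqP; split => // y [z zO _]; exfalso; apply: Omega_T; exists z.
rewrite integral0_eq => [|x _]; last first.
  by rewrite d0 powR0 ?gt_eqF ?(lt_trans ltr01)// invr0 !mulr0.
by rewrite mule0; apply: integral_ge0 => x _; rewrite lee_fin powR_ge0.
Qed.
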